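(* For every $\lambda\in(\frac12,g)$ there exists a set $\widetilde{\mathcal A}_\lambda\subset I_\lambda$, namely the set $\widetilde{\mathcal A}_\lambda$ defined in the context, such that $$d(\nu_\lambda,x)=s(\lambda)>1\quad\text{for all }x\in\widetilde{\mathcal A}_\lambda .$$ Moreover: (i) $\widetilde{\mathcal A}_\lambda$ is countably infinite for every $\lambda\in(\beta_c^{-1},g)$; (ii) $\dim_H\widetilde{\mathcal A}_\lambda>0$ for every $\lambda\in(\frac12,\beta_c^{-1})$; (iii) $\dim_H\widetilde{\mathcal A}_\lambda\to1$ as $\lambda\searrow\frac12$.
   Context: For $\lambda\in(0,1)$, $\nu_\lambda$ denotes the (unbiased) Bernoulli convolution: the distribution of the random series $\sum_{n\ge1}i_n\lambda^n$, where the $i_n$ are i.i.d. taking values $0,1$ with probability $\frac12$ each. $I_\lambda=[0,\frac{\lambda}{1-\lambda}]$. $s(\lambda)=\log2/|\log\lambda|$. The local dimension of a measure $\mu$ on $\mathbb R$ at $x$ is $d(\mu,x)=\lim_{r\searrow0}\frac{\log\mu(B(x,r))}{\log r}$ (with $B(x,r)$ the open ball), and an assertion $d(\mu,x)=\alpha$ includes that the limit exists. $\dim_H$ is Hausdorff dimension. $g=\frac{\sqrt5-1}{2}$. $\beta_c$ is the Komornik–Loreti constant: the unique positive solution of $1=\sum_{n=1}^\infty\mathfrak m_n x^{-n+1}$, where $(\mathfrak m_n)_{n\ge1}=0110\,1001\,1001\,0110\ldots$ is the Thue–Morse sequence; $\beta_c^{-1}=0.5598\ldots$. Definition of $\widetilde{\mathcal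 A}_\lambda$ for $\lambda\in(\frac12,1)$: Let $\mathcal A_\lambda$ be the set of $x\in I_\lambda$ for which there is exactly one sequence $(a_n)_{n\ge1}\in\{0,1\}^{\mathbb N}$ with $x=\sum_{n\ge1}a_n\lambda^n$. Let $\beta=\lambda^{-1}$, $C_\lambda=[\lambda,\frac{\lambda^2}{1-\lambda}]$, and let $F_\beta:I_\lambda\setminus C_\lambda\to I_\lambda$ be given by $F_\beta(x)=\beta x$ for $x\in[0,\lambda)$ and $F_\beta(x)=\beta x-1$ for $x\in(\frac{\lambda^2}{1-\lambda},\frac{\lambda}{1-\lambda}]$. The whole orbit $\{F_\beta^n x\}_{n\ge0}$ is defined if and only if $x\in\mathcal A_\lambda$. For $\delta>0$ put $\widetilde{\mathcal A}_{\lambda,\delta}=\{x\in\mathcal A_\lambda:\operatorname{dist}(\{F_\beta^n x\}_{n\ge0},C_\lambda)\ge\delta\}$, and $\widetilde{\mathcal A}_\lambda=\bigcup_{\delta>0}\widetilde{\mathcal A}_{\lambda,\delta}$. *)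

(* Defs.v *)
From HB Require Import structures.
From mathcomp Require Import all_boot all_order all_algebra finmap.
From mathcomp Require Import all_classical all_reals all_analysis.

Set Implicit Arguments.
Unset Strict Implicit.
Unset Printing Implicit Defensive.

Import Order.TTheory GRing.Theory Num.Theory.
Import numFieldNormedType.Exports.

Local Open Scope classical_set_scope.
Local Open Scope ring_scope.

Section expansions.
Context {R : realType}.
Implicit Types (lam delta x : R) (a : nat -> bool).

(* Digit sequences (a_n)_{n >= 1} in {0,1} are encoded as nat -> bool with the
   index shifted by one: a 0 is the digit of weight lam. *)
Definition expansion lam a : R :=
  limn (series (fun n => (a n)%:R * lam ^+ n.+1)).

Definition Iset lam : set R := [set x | 0 <= x <= lam / (1 - lam)].

Definition Cset lam : set R := [set x | lam <= x <= lam ^+ 2 / (1 - lam)].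

(* F_beta with beta = 1/lam. Only its values on I_lam \ C_lam matter: the
   orbit of a point of Aset lam remains there. *)
Definition Fbeta lam x : R :=
  if x < lam then lam^-1 * x else lam^-1 * x - 1.

Definition Aset lam : set R :=
  [set x | Iset lam x /\ exists! a : nat -> bool, x = expansion lam a].

Definition set_dist (A B : set R) : \bar R :=
  ereal_inf [set `|p.1 - p.2|%:E | p in A `*` B].

Definition Atilde_delta lam delta : set R :=
  [set x | Aset lam x /\
    (delta%:E <=
      set_dist (range (fun n => iter n (Fbeta lam) x)) (Cset lam))%E].

Definition Atilde lam : set R :=
  \bigcup_(delta in [set d : R | 0 < d]) Atilde_delta lam delta.

Definition golden : R := (Num.sqrt 5 - 1) / 2.

Definition sdim lam : R := ln 2 / `|ln lam|.

End expansions.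

(* t_n = m_{n+1} = parity of the number of binary digits 1 of n *)
Definition thue_morse (n : nat) : bool :=
  odd (\sum_(j < n) odd (n %/ 2 ^ j))%N.

(* The Komornik-Loreti constant; since t_n = m_{n+1}, the defining series
   sum_{n >= 1} m_n x^(-n+1) is sum_{n >= 0} t_n x^(-n). *)
Definition beta_c (R : realType) : R :=
  xget 0 [set x : R | 0 < x /\
    series (fun n => (thue_morse n)%:R * x ^- n) @ \oo --> (1 : R)].

Section bernoulli_convolution.
Context {d : measure_display} {T : measurableType d} {R : realType}.
Variables (P : probability T R) (X : nat -> {RV P >-> bool}).

Definition mutually_independent : Prop :=
  forall (J : {fset nat}) (B : nat -> set bool),
    (forall j, measurable (B j)) ->
    P (\bigcap_(j in [set` J]) (X j @^-1` B j)) =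
    (\prod_(j <- J) P (X j @^-1` B j))%E.

Definition iid_fair_bits : Prop :=
  mutually_independent /\
  forall n, distribution P (X n) = bernoulli_prob (2^-1 : R).

(* the distribution of the random series; the nth digit is X (n - 1) *)
Definition bernoulli_convolution (lam : R) : set R -> \bar R :=
  pushforward P (fun w => expansion lam (fun n => X n w)).

End bernoulli_convolution.

Section dimensions.
Context {R : realType}.
Implicit Types (mu : set R -> \bar R) (A U : set R) (x s delta : R).

(* d(mu, x) = alpha, existence of the limit included; with lne 0 = -oo, a
   point outside the support of mu has local dimension +oo. *)
Definition has_local_dim mu x (alpha : \bar R) : Prop :=
  (lne (mu (ball x r)) * ((ln r)^-1)%:E)%E @[r --> 0^'+] --> alpha.

Definition diam U : \bar R :=
  ereal_sup [set `|p.1 - p.2|%:E | p in U `*` U].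

(* |U|^s, where the empty set contributes 0 for every s, including s = 0 *)
Definition diam_pow s U : \bar R :=
  if `[< U = set0 >] then 0%E else (diam U `^ s)%E.

Definition hausdorff_content s delta A : \bar R :=
  ereal_inf [set (\sum_(0 <= i <oo) diam_pow s (U i))%E |
    U in [set U : nat -> set R | A `<=` \bigcup_i U i /\
                                 forall i, (diam (U i) <= delta%:E)%E]].

Definition hausdorff_measure s A : \bar R :=
  ereal_sup [set hausdorff_content s delta A | delta in [set e : R | 0 < e]].

Definition hausdorff_dim A : \bar R :=
  ereal_inf [set s%:E | s in [set s : R | 0 <= s /\
                                          hausdorff_measure s A = 0%E]].

End dimensions.

(* Main.v *)
(* A digit sequence [a] codes a point whose orbit stays at distance at least
   [delta] from the overlap iff the value of every tail of [a], complemented so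
   as to start with 0, is at most [lam - delta].  For such a point the ball of
   radius about [lam ^ n] is, up to a bounded factor, the cylinder of the first
   [n] digits, of measure [2 ^ -n]; this gives the local dimension.

   The condition on values follows from a lexicographic one.  The substitution
   theta : 0 -> 01, 1 -> 10 turns a lexicographic bound [G] on tails into the
   bound [theta G], and its iterates converge to the Thue-Morse sequence, whose
   value crosses [lam] at [lam = 1 / beta_c].  Below this parameter,
   [theta ^ n] of the full shift is therefore admissible for large [n], and a
   Hoelder map from the corresponding points onto [0, 1] yields positive
   dimension; near 1/2 blocks of free digits followed by 01 do the same with
   exponent close to 1.  Above it, every admissible sequence has all its tails
   below the Thue-Morse sequence with a first difference of bounded index, and
   undoing theta finitely many times leaves only countably many sequences. *)

Require Import Defs.
From HB Require Import structures.
From mathcomp Require Import all_boot all_order all_algebra finmap.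
From mathcomp Require Import all_classical all_reals all_analysis.
From mathcomp Require Import ring lra zify.

Import Order.TTheory GRing.Theory Num.Theory.
Import numFieldNormedType.Exports.

Local Open Scope classical_set_scope.
Local Open Scope ring_scope.

(** * Expansions in base 1/lam *)

Definition tail (n : nat) (a : nat -> bool) : nat -> bool := fun j => a (n + j)%N.

Definition flip (a : nat -> bool) : nat -> bool := fun j => ~~ a j.

Lemma tail0 (a : nat -> bool) : tail 0 a = a.
Proof. by apply/funext => j. Qed.

Lemma tailD (m n : nat) (a : nat -> bool) : tail m (tail n a) = tail (n + m) a.
Proof. by apply/funext => j; rewrite /tail addnA. Qed.

Section expansion_theory.
Context {R : realType} (lam : R).
Hypotheses (lam0 : 0 < lam) (lam1 : lam < 1).
Implicit Types a b : nat -> bool.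

Let lamge0 : 0 <= lam := ltW lam0.
Let oml : 0 < 1 - lam. Proof. by rewrite subr_gt0. Qed.

Definition partial a (n : nat) : R := \sum_(0 <= i < n) (a i)%:R * lam ^+ i.+1.

Lemma exprlam_cvg0 (c : R) : (fun n => lam ^+ n * c) @ \oo --> (0 : R).
Proof.
rewrite -[X in _ --> X](mul0r c); apply: cvgM; last exact: cvg_cst.
by apply: cvg_expr; rewrite ger0_norm.
Qed.

Lemma expr_small (c e : R) : 0 < e -> exists n, lam ^+ n * c < e.
Proof.
move=> e0; have /cvgrPdist_lt /(_ _ e0) [n _ H] := exprlam_cvg0 c.
exists n; have := H n (leqnn n); rewrite /= sub0r normrN.
exact: le_lt_trans (ler_norm _).
Qed.

Lemma partial_le a n : partial a n <= lam / (1 - lam).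
Proof.
(* The factor [1 - lam ^+ n] gives the exact geometric sum, which the induction needs. *)
suff : partial a n <= lam / (1 - lam) * (1 - lam ^+ n).
  move/le_trans; apply; rewrite ler_piMr ?divr_ge0// ?(ltW oml)//.
  by rewrite lerBlDr lerDl exprn_ge0.
elim: n => [|n IHn]; first by rewrite /partial big_nil expr0 subrr mulr0.
rewrite /partial big_nat_recr//= -/(partial a n).
have -> : lam / (1 - lam) * (1 - lam ^+ n.+1) =
    lam / (1 - lam) * (1 - lam ^+ n) + 1 * lam ^+ n.+1.
  by rewrite exprS; field; rewrite gt_eqF.
by apply: lerD => //; rewrite ler_wpM2r ?exprn_ge0//; case: (a n).
Qed.

Lemma expansion_cvg a : partial a @ \oo --> expansion lam a.
Proof.
have : cvgn (partial a).
  apply: nondecreasing_is_cvgn.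
    apply/nondecreasing_seqP => n; rewrite /partial big_nat_recr//= lerDl.
    by rewrite mulr_ge0// exprn_ge0.
  by exists (lam / (1 - lam)) => _ [n _ <-]; exact: partial_le.
by [].
Qed.

Lemma partial_step a (v : nat -> R) n :
  (forall n, v n = (a n)%:R * lam + lam * v n.+1) ->
  v 0 = partial a n + lam ^+ n * v n.
Proof.
move=> Hv; elim: n => [|n IHn]; first by rewrite /partial big_nil expr0 mul1r add0r.
rewrite IHn /partial big_nat_recr//= {1}Hv !exprS; ring.
Qed.

(** Iterating the recursion leaves the remainder [lam ^+ n * v n], which tends to 0 because [v] is
    bounded. Expansions are evaluated below by guessing the values of all tails. *)
Lemma expansion_unique a (v : nat -> R) (B : R) :
  (forall n, `|v n| <= B) ->
  (forall n, v n = (a n)%:R * lam + lam * v n.+1) ->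
  expansion lam a = v 0.
Proof.
move=> vB Hv; apply: cvg_lim => //; rewrite -/(partial a).
have -> : series (fun n => (a n)%:R * lam ^+ n.+1) = (fun n => v 0 - lam ^+ n * v n).
  by apply/funext => n; rewrite (partial_step a v n Hv) addrK.
rewrite -[X in _ --> X]subr0; apply: cvgB; first exact: cvg_cst.
apply/norm_cvg0P; apply: (squeeze_cvgr _ (cvg_cst 0) (exprlam_cvg0 B)).
apply: nearW => n; rewrite normr_ge0 normrM normrX (ger0_norm lamge0).
by rewrite ler_wpM2l ?exprn_ge0.
Qed.

Lemma expansion_ge0 a : 0 <= expansion lam a.
Proof.
apply: (limr_ge (cvgP _ (expansion_cvg a))); apply: nearW => n.
by apply: sumr_ge0 => i _; rewrite mulr_ge0// exprn_ge0.
Qed.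

Lemma expansion_le a : expansion lam a <= lam / (1 - lam).
Proof.
by apply: (limr_le (cvgP _ (expansion_cvg a))); apply: nearW => n; exact: partial_le.
Qed.

Lemma expansion_rec a :
  expansion lam a = (a 0%N)%:R * lam + lam * expansion lam (tail 1 a).
Proof.
apply: cvg_lim => //; rewrite -/(partial a) -cvg_shiftS.
have -> : (fun n => partial a n.+1) =
    (fun n => (a 0%N)%:R * lam + lam * partial (tail 1 a) n).
  apply/funext => n; rewrite /partial big_nat_recl//= expr1 mulr_sumr.
  congr (_ + _); apply: eq_bigr => i _; rewrite /tail add1n exprS; ring.
apply: cvgD; first exact: cvg_cst.
by apply: cvgM; [exact: cvg_cst|exact: expansion_cvg].
Qed.

Lemma expansion_tail_rec a n : expansion lam (tail n a) =
  (a n)%:R * lam + lam * expansion lam (tail n.+1 a).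
Proof. by rewrite expansion_rec tailD addn1 /tail addn0. Qed.

Lemma expansion_split a n :
  expansion lam a = partial a n + lam ^+ n * expansion lam (tail n a).
Proof.
rewrite -{1}(tail0 a).
exact: (partial_step a (fun n => expansion lam (tail n a)) n (expansion_tail_rec a)).
Qed.

Lemma eq_partial a b n : (forall j, (j < n)%N -> a j = b j) ->
  partial a n = partial b n.
Proof. by move=> ab; apply: eq_big_nat => i /andP[_ ?]; rewrite ab. Qed.

Lemma partialS a n : partial a n.+1 = partial a n + (a n)%:R * lam ^+ n.+1.
Proof. by rewrite /partial big_nat_recr. Qed.

Lemma expansion_flip a : expansion lam (flip a) = lam / (1 - lam) - expansion lam a.
Proof.
rewrite -[in RHS](tail0 a).
apply: (expansion_unique _ (fun n => lam / (1 - lam) - expansion lam (tail n a))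
  (lam / (1 - lam))) => n.
  have := expansion_ge0 (tail n a); have := expansion_le (tail n a).
  by move=> H1 H2; rewrite ger0_norm; lra.
rewrite expansion_tail_rec /flip; case: (a n) => /=; field; by rewrite gt_eqF.
Qed.

Lemma dist_expansion a b n : (forall j, (j < n)%N -> a j = b j) ->
  `|expansion lam a - expansion lam b| <= lam ^+ n * (lam / (1 - lam)).
Proof.
move=> ab; rewrite (expansion_split a n) (expansion_split b n) (eq_partial a b n ab).
rewrite opprD addrACA subrr add0r -mulrBr normrM ger0_norm ?exprn_ge0//.
rewrite ler_wpM2l ?exprn_ge0//.
have := expansion_ge0 (tail n a); have := expansion_le (tail n a).
have := expansion_ge0 (tail n b); have := expansion_le (tail n b).
by move=> *; rewrite ler_norml; lra.
Qed.

End expansion_theory.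

(** * Orbits avoiding the overlap *)

(* Complementing digits is the symmetry x |-> lam / (1 - lam) - x of the
   interval, so conditions on both sides of the overlap [Cset lam] become a
   single condition on [rtail a i], which always starts with 0. *)
Definition rtail (a : nat -> bool) (i : nat) : nat -> bool :=
  fun j => a (i + j)%N (+) a i.

(** A tail starting with 0 lies at least [d] below the left end of [Cset lam], one starting with 1
    at least [d] above its right end. *)
Definition gap {R : realType} (lam d : R) (a : nat -> bool) : Prop :=
  forall i, expansion lam (rtail a i) <= lam - d.

(** Non-strict lexicographic order, phrased so that no first difference has to be chosen. *)
Definition lexle (a b : nat -> bool) : Prop :=
  forall k, (forall j, (j < k)%N -> a j = b j) -> a k ==> b k.

Definition zero_cons (a : nat -> bool) : nat -> bool :=
  fun n => if n is n'.+1 then a n' else false.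

Lemma rtail0 a i : rtail a i 0%N = false.
Proof. by rewrite /rtail addn0 addbb. Qed.

Lemma rtailE a i : rtail a i = if a i then flip (tail i a) else tail i a.
Proof.
apply/funext => j; rewrite /rtail /flip /tail; case: (a i) => /=;
by rewrite ?addbT ?addbF.
Qed.

(** A digit 0 at [k] means [a (i + k) = a i], so both tails are complemented or neither is. *)
Lemma tail_rtail a i k : rtail a i k = false -> tail k (rtail a i) = rtail a (i + k).
Proof.
rewrite /rtail => /negbT; rewrite -addNb => /addbP aik.
by apply/funext => j; rewrite /tail -aik negbK addnA.
Qed.

Lemma lexle_trans a b c : lexle a b -> lexle b c -> lexle a c.
Proof.
move=> ab bc k ac.
(* The middle sequence is squeezed: where [a] and [c] agree, [b] agrees with them too. *)
have acb : forall j, (j <= k)%N -> (forall i, (i < j)%N -> a i = b i).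
  elim=> [//|j IHj] jk i; rewrite ltnS leq_eqVlt => /orP[/eqP->|]; last first.
    by apply: IHj; exact: ltnW.
  have H := IHj (ltnW jk).
  have Hb : forall i0, (i0 < j)%N -> b i0 = c i0.
    by move=> i0 i0j; rewrite -H// ac// (ltn_trans i0j).
  move: (ab _ H) (bc _ Hb); rewrite -(ac j jk).
  by case: (a j); case: (b j).
have H := acb k (leqnn k).
have Hb : forall i0, (i0 < k)%N -> b i0 = c i0 by move=> i0 i0k; rewrite -H// ac.
by move: (ab _ H) (bc _ Hb); case: (a k); case: (b k).
Qed.

Lemma ex_first_diff (a b : nat -> bool) : a <> b ->
  exists n, (forall j, (j < n)%N -> a j = b j) /\ a n != b n.
Proof.
move=> ab; have [n nab] : exists n, a n != b n.
  by apply: contra_notP ab => H; apply/funext => n; apply/eqP/negPn/negP => ?; apply: H; exists n.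
case: (ex_minnP (ex_intro (fun n => a n != b n) n nab)) => m mab mmin; exists m; split => // j jm.
by apply/eqP/negPn/negP => /mmin; rewrite leqNgt jm.
Qed.

Section gap_theory.
Context {R : realType} (lam : R).
Hypotheses (lam0 : 0 < lam) (lam1 : lam < 1).
Implicit Types a b : nat -> bool.

Let lamge0 : 0 <= lam := ltW lam0.
Let oml : 0 < 1 - lam. Proof. by rewrite subr_gt0. Qed.

Lemma Cset_rightE : lam / (1 - lam) - lam = lam ^+ 2 / (1 - lam).
Proof. by field; rewrite gt_eqF. Qed.

Lemma expansion_rtail a i : expansion lam (rtail a i) =
  if a i then lam / (1 - lam) - expansion lam (tail i a)
  else expansion lam (tail i a).
Proof. by rewrite rtailE; case: (a i) => //; rewrite expansion_flip. Qed.

Lemma expansion_digit1 b n : b n -> lam <= expansion lam (tail n b).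
Proof.
move=> bn; rewrite expansion_tail_rec// bn mul1r lerDl mulr_ge0//.
exact: expansion_ge0.
Qed.

Lemma expansion_digit0 b n : ~~ b n ->
  expansion lam (tail n b) <= lam ^+ 2 / (1 - lam).
Proof.
move=> /negPf bn; rewrite expansion_tail_rec// bn mul0r add0r expr2 -mulrA.
by rewrite ler_pM2l//; exact: expansion_le.
Qed.

(** At the first difference the tail of [a] is at distance at least [d] from every value of a
    sequence starting with the other digit; [b] itself is arbitrary. *)
Lemma gap_dist d a b n : gap lam d a -> (forall j, (j < n)%N -> a j = b j) ->
  a n != b n -> lam ^+ n * d <= `|expansion lam a - expansion lam b|.
Proof.
move=> ga ab nab; rewrite (expansion_split _ _ _ a n)// (expansion_split _ _ _ b n)//.
rewrite (eq_partial _ a b n ab) opprD addrACA subrr add0r -mulrBr normrM.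
rewrite ger0_norm ?exprn_ge0// ler_wpM2l ?exprn_ge0//.
move: (ga n); rewrite expansion_rtail; case: ifP nab => an.
  case bn : (b n) => // _ h.
  have := expansion_digit0 b n; rewrite bn -Cset_rightE => /(_ isT) h2.
  by apply: le_trans (ler_norm _); lra.
case bn : (b n) => // _ h; have h2 := expansion_digit1 b n bn.
by rewrite distrC; apply: le_trans (ler_norm _); lra.
Qed.

Lemma gap_inj d a b : 0 < d -> gap lam d a ->
  expansion lam a = expansion lam b -> a = b.
Proof.
move=> d0 ga eab; apply: contrapT => /ex_first_diff [n [ab nab]].
have := gap_dist _ _ _ _ ga ab nab; rewrite eab subrr normr0.
by rewrite leNgt mulr_gt0// exprn_gt0.
Qed.

Lemma Fbeta_tail a n :
  (a n = ~~ (expansion lam (tail n a) < lam)) ->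
  Fbeta lam (expansion lam (tail n a)) = expansion lam (tail n.+1 a).
Proof.
rewrite /Fbeta; case: ifPn => _ /= an; rewrite {1}expansion_tail_rec// an /=;
by field; rewrite gt_eqF.
Qed.

(** A tail with first digit 0 and value at least [lam] lies in [Cset lam], so avoiding this set
    forces the digits of [a] to be those selected by [Fbeta], and the orbit consists of the tail
    values. Since [2^-1 < lam], both end points belong to [Cset lam] and the distance can be tested
    against them. *)
Lemma Atilde_delta_gap d a : 2^-1 < lam -> 0 < d ->
  Atilde_delta lam d (expansion lam a) -> gap lam d a.
Proof.
move=> lam2 d0 [_ /= /ereal_infP Hd].
have lamC : Cset lam lam.
  rewrite /Cset/= lexx/= -Cset_rightE lerBrDl ler_pdivlMr//; nra.
have rC : Cset lam (lam ^+ 2 / (1 - lam)).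
  by move: lamC => /andP[_ h]; apply/andP; rewrite lexx.
have far n c : Cset lam c -> d <= `|iter n (Fbeta lam) (expansion lam a) - c|.
  move=> Cc; rewrite -lee_fin; apply: Hd => /=.
  exists (iter n (Fbeta lam) (expansion lam a), c) => //=.
  by split => //=; exists n.
have dig n : iter n (Fbeta lam) (expansion lam a) = expansion lam (tail n a) ->
    a n = ~~ (expansion lam (tail n a) < lam).
  move=> orbn; case an: (a n).
    by rewrite -leNgt expansion_digit1.
  apply/esym/negbTE; rewrite negbK ltNge; apply/negP => lame.
  have Cn : Cset lam (expansion lam (tail n a)).
    by rewrite /Cset/= lame expansion_digit0// an.
  by have := far n _ Cn; rewrite orbn subrr normr0 leNgt d0.
have orb n : iter n (Fbeta lam) (expansion lam a) = expansion lam (tail n a).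
  elim: n => [|n IHn]; first by rewrite tail0.
  by rewrite iterS IHn Fbeta_tail//; exact: dig.
move=> i; rewrite expansion_rtail; have := dig _ (orb i); case: ifP => ai.
  move=> _; have h : expansion lam (tail i a) >= lam ^+ 2 / (1 - lam).
    rewrite leNgt; apply/negP => h.
    have Ci : Cset lam (expansion lam (tail i a)).
      by rewrite /Cset/= expansion_digit1//= ltW.
    by have := far i _ Ci; rewrite orb subrr normr0 leNgt d0.
  have := far i _ rC; rewrite orb ger0_norm ?subr_ge0// -Cset_rightE; lra.
move=> /esym/negbT; rewrite negbK => h.
by have := far i _ lamC; rewrite orb ltr0_norm ?subr_lt0//; lra.
Qed.

Lemma gap_Atilde_delta d a : 0 < d -> gap lam d a ->
  Atilde_delta lam d (expansion lam a).
Proof.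
move=> d0 ga.
have dig n : a n = ~~ (expansion lam (tail n a) < lam).
  have := ga n; rewrite expansion_rtail; case: ifP => an h.
    by rewrite -leNgt expansion_digit1.
  by apply/esym/negbTE; rewrite negbK; lra.
have orb n : iter n (Fbeta lam) (expansion lam a) = expansion lam (tail n a).
  by elim: n => [|n IHn]; rewrite ?tail0// iterS IHn Fbeta_tail.
split; first split.
- by rewrite /Iset/= expansion_ge0// expansion_le.
- by exists a; split => // b; exact: gap_inj ga.
apply: le_ereal_inf_tmp => _ [[_ c] [/= [n _ <-] Cc] <-].
rewrite lee_fin/= orb; move: Cc; rewrite /Cset/= -Cset_rightE => /andP[c1 c2].
have := ga n; rewrite expansion_rtail; case: ifP => an h.
  by apply: le_trans (ler_norm _); lra.
by rewrite distrC; apply: le_trans (ler_norm _); lra.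
Qed.

(* At the first difference with [G] the remaining digits of [rtail a i] form
   some [rtail a (i + k)], so that a common upper bound
   [expansion lam G + B] improves to [expansion lam G + lam * B]. *)
Lemma lexle_expansion a G : G 0%N = false ->
  (forall i, lexle (rtail a i) G) -> expansion lam G <= lam ->
  forall i, expansion lam (rtail a i) <= expansion lam G.
Proof.
move=> G0 aG Gl; set B := lam / (1 - lam).
have B0 : 0 <= B by rewrite divr_ge0// ltW.
have H m : forall i, expansion lam (rtail a i) <= expansion lam G + lam ^+ m * B.
  elim: m => [|m IHm] i.
    rewrite expr0 mul1r; apply: (le_trans (expansion_le _ lam0 lam1 _)).
    by rewrite lerDr expansion_ge0.
  have [->|/ex_first_diff [k [akG nk]]] := pselect (rtail a i = G).
    by rewrite lerDl mulr_ge0// exprn_ge0.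
  have /negPf rk : ~~ rtail a i k.
    by apply: contra_neqN nk => rk; have := aG i k akG; rewrite rk => /= ->.
  have Gk : G k by move: nk; rewrite rk; case: (G k).
  (* The first difference is not at 0, where both sequences are 0; a positive [k] gains the factor
     [lam]. *)
  have k0 : (0 < k)%N by case: k Gk {akG nk rk} => //; rewrite G0.
  rewrite (expansion_split _ _ _ (rtail a i) k)// tail_rtail// (eq_partial _ _ _ _ akG).
  have := expansion_split _ lam0 lam1 G k.+1; rewrite partialS Gk mul1r => eG.
  have lk : lam ^+ k <= lam by rewrite -(prednK k0) exprS ler_piMr// exprn_ile1// ltW.
  have lk0 : 0 < lam ^+ k by rewrite exprn_gt0.
  have t0 : 0 <= lam ^+ k.+1 * expansion lam (tail k.+1 G).
    by rewrite mulr_ge0 ?expansion_ge0// exprn_ge0.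
  have h1 : partial lam G k <= expansion lam G - lam ^+ k.+1 by lra.
  have h2 := ler_wpM2l (ltW lk0) (IHm (i + k)%N).
  have h3 : lam ^+ k * (expansion lam G) <= lam ^+ k * lam by rewrite ler_pM2l.
  have h4 : lam ^+ k * (lam ^+ m * B) <= lam ^+ m.+1 * B.
    by rewrite exprS -mulrA ler_wpM2r// mulr_ge0// exprn_ge0.
  rewrite exprSr in h1; move: h2; rewrite mulrDr; lra.
move=> i; apply/ler_addgt0Pr => e e0.
have [m me] := expr_small _ lam0 lam1 B e e0.
by apply: (le_trans (H m i)); rewrite lerD2l ltW.
Qed.

(** On [Cset lam] the map [Fbeta] takes the branch of digit 1, so this itinerary is the
    lexicographically largest expansion. *)
Definition greedy (y : R) : nat -> bool := fun n => lam <= iter n (Fbeta lam) y.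

Section greedy_theory.
Hypothesis lam2 : 2^-1 <= lam.
Variable y : R.
Hypothesis yI : 0 <= y <= lam / (1 - lam).

Lemma greedy_orbit n : 0 <= iter n (Fbeta lam) y <= lam / (1 - lam).
Proof.
elim: n => [//|n /andP[h1 h2]]; rewrite iterS /Fbeta.
(* Points below [lam] are mapped below 1, which is still in the interval because [lam] is at least
   1/2. *)
have l1 : 1 <= lam / (1 - lam) by move: lam2 => h; rewrite ler_pdivlMr//; lra.
have e : lam * (lam / (1 - lam)) = lam / (1 - lam) - lam by field; rewrite gt_eqF.
case: ltP => h; rewrite mulrC.
  rewrite divr_ge0//=; apply: le_trans l1; rewrite ler_pdivrMr// mul1r ltW//.
rewrite subr_ge0 ler_pdivlMr// mul1r h/= lerBlDr ler_pdivrMr// mulrDl mul1r mulrC e.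
by rewrite subrK.
Qed.

Lemma greedy_rec n : iter n (Fbeta lam) y =
  (greedy y n)%:R * lam + lam * iter n.+1 (Fbeta lam) y.
Proof.
rewrite iterS /greedy /Fbeta; case: ltP => h /=; field; by rewrite gt_eqF.
Qed.

Lemma expansion_greedy : expansion lam (greedy y) = y.
Proof.
apply: (expansion_unique _ lam0 lam1 _ (fun n => iter n (Fbeta lam) y)
  (lam / (1 - lam))) => n; last exact: greedy_rec.
by have /andP[? ?] := greedy_orbit n; rewrite ger0_norm.
Qed.

(** If [a] had 1 against a greedy 0 after a common prefix, the remainder of [y] would be below [lam]
    and the tail of [a] at least [lam], so [a] would have the larger value. *)
Lemma lexle_greedy a : expansion lam a < y -> lexle a (greedy y).
Proof.
move=> ay k ak; apply/implyP => ak1; rewrite /greedy leNgt; apply/negP => h.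
have := partial_step _ (greedy y) _ k greedy_rec => /= ey.
have := expansion_split _ lam0 lam1 a k; rewrite (eq_partial _ _ _ _ ak) => ea.
have lk0 : 0 < lam ^+ k by rewrite exprn_gt0.
have := ler_wpM2l (ltW lk0) (expansion_digit1 _ _ ak1).
have := ltr_pM2l lk0 (iter k (Fbeta lam) y) lam; rewrite h; lra.
Qed.

End greedy_theory.

End gap_theory.

(** * Thue-Morse combinatorics *)

Definition theta (c : nat -> bool) : nat -> bool := fun n => c n./2 (+) odd n.

(** The largest sequence starting with 0, hence a trivial bound for every [rtail]; the iteration of
    [theta] starts from it. *)
Definition lead_zero_ones : nat -> bool := fun n => (0 < n)%N.

Lemma theta_thue_morse : theta thue_morse = thue_morse.
Proof.
(* The cutoff in the binary digit sum may be raised, since all further digits are 0. *)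
have stable n k : (n <= k)%N ->
    odd (\sum_(j < k) odd (n %/ 2 ^ j))%N = thue_morse n.
  move=> nk; rewrite /thue_morse -(subnKC nk) big_split_ord/=.
  rewrite [X in (_ + X)%N]big1 ?addn0// => i _.
  rewrite divn_small//; apply: (leq_trans (ltn_expl n (ltnSn 1))).
  by rewrite leq_exp2l// leq_addr.
apply/funext => n; rewrite /theta -(stable n n.+1)// big_ord_recl expn0 divn1 oddD.
rewrite oddb addbC; congr addb; rewrite -(stable n./2 n); last first.
  by rewrite -{2}(odd_double_half n) -addnn addnCA leq_addr.
congr odd; apply: eq_bigr => i _.
by rewrite lift0 expnS divnMA divn2.
Qed.

Lemma thue_morse0 : thue_morse 0 = false.
Proof. by rewrite /thue_morse big_ord0. Qed.

Lemma thue_morseE n : thue_morse n = thue_morse n./2 (+) odd n.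
Proof. by rewrite -{1}theta_thue_morse. Qed.

Lemma thue_morse_double n : thue_morse n.*2 = thue_morse n.
Proof. by rewrite thue_morseE doubleK odd_double addbF. Qed.

Lemma iter_theta_thue_morse m c j : c 0%N = false -> (j < 2 ^ m)%N ->
  iter m theta c j = thue_morse j.
Proof.
move=> c0; elim: m j => [|m IHm] j.
  by rewrite expn0 ltnS leqn0 => /eqP ->; rewrite thue_morse0.
rewrite expnS => jm; rewrite iterS [LHS]/theta thue_morseE IHm//.
by rewrite -divn2 ltn_divLR// mulnC.
Qed.

Lemma lexle_theta a b : lexle a b -> lexle (theta a) (theta b).
Proof.
move=> ab k; rewrite -(odd_double_half k); case: (odd k); move: k./2 => m abk.
  have := abk m.*2 (ltnSn _).
  by rewrite /theta /= doubleK uphalf_double odd_double !addbF => ->; exact: implybb.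
rewrite add0n /theta doubleK odd_double !addbF; apply: ab => j jm.
have := abk j.*2; rewrite /theta doubleK odd_double !addbF; apply.
by rewrite add0n ltn_double.
Qed.

Lemma rtail_theta_even b m : rtail (theta b) m.*2 = theta (rtail b m).
Proof.
apply/funext => j; rewrite /rtail /theta halfD odd_double doubleK /=.
by rewrite addbF oddD odd_double /=; rewrite add0n addbAC.
Qed.

(** At even positions [theta] commutes with [rtail]. A tail from an odd position continues with a
    whole block, whose two digits differ, while [theta G] starts with 011; it drops below by index
    2. *)
Lemma rtail_theta b G : G 0%N = false -> G 1%N ->
  (forall i, lexle (rtail b i) G) -> forall i, lexle (rtail (theta b) i) (theta G).
Proof.
move=> G0 G1 bG i; rewrite -(odd_double_half i); case: (odd i); last first.
  by rewrite add0n rtail_theta_even; exact: lexle_theta.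
move: i./2 => m; rewrite add1n; move=> [|[|[|k]]].
- by rewrite rtail0.
- by rewrite /theta/= G0 implybT.
- by rewrite /theta/= G1 implybT.
move=> H; have := H 1%N isT; have := H 2%N isT.
rewrite /rtail /theta addn1 addn2 /= doubleK uphalf_double odd_double/= G0 G1.
by case: (b m); case: (b m.+1).
Qed.

Lemma rtail_iter_theta m b i :
  lexle (rtail (iter m theta b) i) (iter m theta lead_zero_ones).
Proof.
have H0 : forall m, iter m theta lead_zero_ones 0%N = false.
  by elim=> [//|k IHk]; rewrite iterS /theta/= IHk.
have H1 : forall m, iter m theta lead_zero_ones 1%N.
  by elim=> [//|k IHk]; rewrite iterS /theta/= H0.
elim: m i => [|m IHm] i; last by rewrite !iterS; apply: rtail_theta.
by move=> [|k] _ /=; rewrite ?rtail0// implybT.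
Qed.

Lemma iter_theta_fix m : iter m theta thue_morse = thue_morse.
Proof. by elim: m => [//|m IHm]; rewrite iterS IHm theta_thue_morse. Qed.

(** The Thue-Morse sequence is fixed by [theta], so [rtail_iter_theta] applies to it for every
    exponent; exponent [k] suffices to compare at index [k]. *)
Lemma rtail_thue_morse i : lexle (rtail thue_morse i) thue_morse.
Proof.
move=> k H; have k2 : (k < 2 ^ k)%N by rewrite ltn_expl.
have := rtail_iter_theta k thue_morse i; rewrite iter_theta_fix => /(_ k).
rewrite iter_theta_thue_morse//; apply => j jk.
by rewrite iter_theta_thue_morse ?H// (ltn_trans jk).
Qed.

(** Undoing [theta] halves the uniform bound [N] on the first difference, which makes the descent
    finite. *)
Definition tm_below (N : nat) : set (nat -> bool) :=
  [set a | forall i, exists j, [/\ (j <= N)%N,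
     (forall k, (k < j)%N -> rtail a i k = thue_morse k),
     rtail a i j = false & thue_morse j]].

Lemma tm_below_tail N a q : tm_below N a -> tm_below N (tail q a).
Proof.
move=> aN i; have [j [jN H1 H2 H3]] := aN (q + i)%N; exists j.
have E k : rtail (tail q a) i k = rtail a (q + i) k by rewrite /rtail /tail addnA.
by split => // [k kj|]; rewrite E// H1.
Qed.

(** The second digit of a block is determined by the first, so the first difference sits at an even
    index, which is then halved. *)
Lemma tm_below_theta n c : tm_below (2 ^ n.+1) (theta c) -> tm_below (2 ^ n) c.
Proof.
move=> H i; have [j [jN H1 H2 H3]] := H i.*2.
rewrite rtail_theta_even in H1 H2.
have ej : ~~ odd j.
  apply/negP => oj; have := H1 j.-1; rewrite prednK ?odd_gt0// => /(_ (leqnn _)).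
  move: H2 H3; rewrite thue_morseE (thue_morseE j.-1) /theta.
  have -> : j = (j./2.*2).+1 by rewrite -[LHS]odd_double_half oj.
  rewrite /= uphalf_double doubleK odd_double /= !addbT !addbF => /negbFE ->.
  by case: (thue_morse _).
have ejE : j = j./2.*2 by rewrite -[LHS]odd_double_half (negPf ej).
exists j./2; split.
- by rewrite -leq_double -ejE -mul2n -expnS.
- move=> k kj; have := H1 k.*2.
  rewrite {1}ejE ltn_double => /(_ kj); rewrite thue_morse_double /theta.
  by rewrite doubleK odd_double addbF.
- by move: H2; rewrite /theta (negPf ej) addbF.
- by move: H3; rewrite {1}ejE thue_morse_double.
Qed.

Lemma tm_values : [/\ thue_morse 1, thue_morse 2, ~~ thue_morse 3,
  thue_morse 4 & ~~ thue_morse 5 /\ ~~ thue_morse 6].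
Proof.
by rewrite (thue_morseE 6) (thue_morseE 5) (thue_morseE 4) /= (thue_morseE 3)
  (thue_morseE 2) /= (thue_morseE 1) /= thue_morse0.
Qed.

(** * Excluded words and alignment into blocks *)

Section blocks.
Variables (N : nat) (a : nat -> bool).
Hypothesis aN : tm_below N a.

(** The Thue-Morse sequence begins with 0110100, so 0111 is too large as a prefix of a normalized
    tail; likewise 011011 and 0110101 in the next two lemmas. *)
Lemma tm_below_no111 i : [/\ rtail a i 1, rtail a i 2 & rtail a i 3] -> False.
Proof.
move=> [r1 r2 r3]; have [t1 t2 t3 t4 [t5 t6]] := tm_values.
have [[|[|[|[|j]]]] [_ H1 H2 H3]] := aN i.
- by rewrite thue_morse0 in H3.
- by rewrite r1 in H2.
- by rewrite r2 in H2.
- by rewrite H3 in t3.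
- by move: (H1 3%N isT) t3; rewrite r3 => <-.
Qed.

Lemma tm_below_no11011 i :
  [/\ rtail a i 1, rtail a i 2, rtail a i 3 = false, rtail a i 4 & rtail a i 5] -> False.
Proof.
move=> [r1 r2 r3 r4 r5]; have [t1 t2 t3 t4 [t5 t6]] := tm_values.
have [[|[|[|[|[|[|j]]]]]] [_ H1 H2 H3]] := aN i.
- by rewrite thue_morse0 in H3.
- by rewrite r1 in H2.
- by rewrite r2 in H2.
- by rewrite H3 in t3.
- by rewrite r4 in H2.
- by rewrite H3 in t5.
- by move: (H1 5%N isT) t5; rewrite r5 => <-.
Qed.

Lemma tm_below_no110101 i : [/\ rtail a i 1, rtail a i 2, rtail a i 3 = false &
  [/\ rtail a i 4, rtail a i 5 = false & rtail a i 6]] -> False.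
Proof.
move=> [r1 r2 r3 [r4 r5 r6]]; have [t1 t2 t3 t4 [t5 t6]] := tm_values.
have [[|[|[|[|[|[|[|j]]]]]]] [_ H1 H2 H3]] := aN i.
- by rewrite thue_morse0 in H3.
- by rewrite r1 in H2.
- by rewrite r2 in H2.
- by rewrite H3 in t3.
- by rewrite r4 in H2.
- by rewrite H3 in t5.
- by rewrite H3 in t6.
- by move: (H1 6%N isT) t6; rewrite r6 => <-.
Qed.

Variable p : nat.
Hypothesis ap : a p != a p.+1.

Lemma before_double u : (p < u)%N -> a u = a u.+1 -> a u.-1 != a u.
Proof.
elim: u => [//|u IHu]; rewrite ltnS leq_eqVlt => /orP[/eqP <- //|pu] du /=.
apply/eqP => e; have := IHu pu e; move: pu e du {IHu}; case: u => [//|u] _ e du /=.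
move=> n; apply: (@tm_below_no111 u); rewrite /rtail addn1 addn2 addn3.
by move: n du e; case: (a u); case: (a u.+1); case: (a u.+2); case: (a u.+3).
Qed.

(** By strong induction no repetition lies strictly between the two, as it would be at odd distance
    from one of them. The digits in between alternate and, with the different digit before [u], form
    0111, 011011 or 0110101 when [d] is 1, 3 or at least 5. *)
Lemma no_odd_doubles d u : odd d -> (p < u)%N ->
  a u = a u.+1 -> a (u + d)%N = a (u + d).+1 -> False.
Proof.
elim/ltn_ind: d u => d IHd u od pu du dw.
have nodbl e : (0 < e < d)%N -> a (u + e)%N != a (u + e).+1.
  move=> /andP[e0 ed]; apply/eqP => de; case: (boolP (odd e)) => oe.
    exact: (IHd e ed u oe pu du de).
  have de' : (d - e < d)%N by rewrite ltn_subrL e0 odd_gt0.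
  apply: (IHd (d - e)%N de' (u + e)%N) => //.
  - by rewrite oddB ?(ltnW ed)// od (negPf oe).
  - by rewrite (leq_trans pu)// leq_addr.
  - by rewrite -addnA subnKC// ltnW.
have := before_double u pu du.
case: u pu du dw nodbl => [//|u] _ du dw nodbl /= n.
case: d od IHd dw nodbl => [//|[|[//|[|[//|d]]]]] od IHd dw nodbl.
- apply: (@tm_below_no111 u); rewrite /rtail addn1 addn2 addn3.
  move: n du dw; rewrite addn1.
  by case: (a u); case: (a u.+1); case: (a u.+2); case: (a u.+3).
- apply: (@tm_below_no11011 u); rewrite /rtail !addnS addn0.
  move: n du dw (nodbl 1%N isT) (nodbl 2%N isT); rewrite !addnS addn0.
  by case: (a u); case: (a u.+1); case: (a u.+2); case: (a u.+3); case: (a u.+4); case: (a u.+4.+1).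
- apply: (@tm_below_no110101 u); rewrite /rtail !addnS addn0.
  move: n du (nodbl 1%N isT) (nodbl 2%N isT) (nodbl 3%N isT) (nodbl 4%N isT).
  rewrite !addnS addn0.
  by case: (a u); case: (a u.+1); case: (a u.+2); case: (a u.+3); case: (a u.+4);
    case: (a u.+4.+1); case: (a u.+4.+2).
Qed.

Lemma ex_block_start : exists q, forall i, a (q + i.*2)%N != a (q + i.*2).+1.
Proof.
have [[u [pu du]]|nod] := pselect (exists u, (p < u)%N /\ a u = a u.+1); last first.
  by exists p.+1 => i; apply/eqP => d; apply: nod; exists (p.+1 + i.*2)%N; split => //; rewrite leq_addr.
(* The offset puts every block start at odd distance from the repetition at [u]. *)
exists (p.+1 + odd (p + u))%N => i; apply/eqP; set w := (_ + i.*2)%N => dw.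
have pw : (p < w)%N by rewrite /w -addnA leq_addr.
have ow : odd (w + u).
  by rewrite /w !oddD odd_double /= oddb; case: (odd p); case: (odd u).
case: (leqP u w) => uw.
  apply: (@no_odd_doubles (w - u) u) => //; last by rewrite subnKC.
  by rewrite oddB// -oddD.
apply: (@no_odd_doubles (u - w) w) => //; last by rewrite subnKC// ltnW.
by rewrite oddB ?(ltnW uw)// -oddD addnC.
Qed.

End blocks.

(* After the first change of digit, immediate repetitions all have the same
   parity, hence fix an alignment into the blocks 01 and 10. *)
Lemma tm_below_renormalize n a : tm_below (2 ^ n.+1) a ->
  exists q, (exists b, tail q a = fun=> b) \/
            (exists2 c, tm_below (2 ^ n) c & tail q a = theta c).
Proof.
move=> aN; have [[p ap]|cst] := pselect (exists p, a p != a p.+1); last first.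
  exists 0%N; left; exists (a 0%N); rewrite tail0; apply/funext; elim=> [//|k IHk].
  by apply: contra_notP cst => H; exists k; apply/eqP => e; apply: H; rewrite -IHk.
have [q Hq] := ex_block_start _ _ aN _ ap; exists q; right.
have E : tail q a = theta (fun i => a (q + i.*2)%N).
  apply/funext => j; rewrite /tail /theta -{1}(odd_double_half j).
  move: (Hq j./2); case: (odd j); rewrite ?addbF// addbT addnCA add1n.
  by case: (a _); case: (a _).
exists (fun i => a (q + i.*2)%N) => //.
by apply: tm_below_theta; rewrite -E; exact: tm_below_tail.
Qed.

Definition prepend (s : seq bool) (c : nat -> bool) : nat -> bool :=
  fun j => if (j < size s)%N then nth false s j else c (j - size s)%N.

Lemma prepend_tail q a : prepend (mkseq a q) (tail q a) = a.
Proof.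
apply/funext => j; rewrite /prepend size_mkseq /tail.
by case: ltnP => jq; [rewrite nth_mkseq|rewrite subnKC].
Qed.

(** Each sequence is a finite prefix followed by a constant sequence or by the image under [theta]
    of a sequence one level down. *)
Lemma countable_tm_below n : countable (tm_below (2 ^ n)).
Proof.
have cst_countable : countable [set a : nat -> bool | exists b, a = fun=> b].
  apply: (@sub_countable _ _ _ ((fun b : bool => (fun=> b) : nat -> bool) @` setT)).
    by apply: subset_card_le => _ [b ->]; exists b.
  exact: sub_countable (card_image_le _ _) _.
elim: n => [|n IHn].
  (* With bound 1 the first difference is at index 1, so every digit equals its successor. *)
  apply: sub_countable cst_countable; apply: subset_card_le => a aN.
  exists (a 0%N); apply/funext; elim=> [//|k <-].
  have [[|[|j]] [//= jN H1 H2 H3]] := aN k; first by rewrite thue_morse0 in H3.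
  by move: H2; rewrite /rtail addn1; case: (a k); case: (a k.+1).
pose D := [set a : nat -> bool | exists b, a = fun=> b] `|` theta @` tm_below (2 ^ n).
apply: (@sub_countable _ _ _ (\bigcup_(s in [set: seq bool]) prepend s @` D)).
  apply: subset_card_le => a /tm_below_renormalize[q Hq].
  exists (mkseq a q) => //; exists (tail q a); last exact: prepend_tail.
  by case: Hq => [[b Hb]|[c cn Hc]]; [left; exists b|right; exists c].
apply: bigcup_countable => // s _; apply: sub_countable (card_image_le _ _) _.
have -> : D = \bigcup_(b in [set: bool]) if b then [set a | exists b, a = fun=> b] else
    theta @` tm_below (2 ^ n).
  apply/seteqP; split => [c [?|?]|c [[] _ ?]]; [by exists true|by exists false|by left|by right].
by apply: bigcup_countable => // -[] _ //; exact: sub_countable (card_image_le _ _) _.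
Qed.

(** * The Komornik-Loreti constant *)

Section monotonicity.
Context {R : realType}.
Implicit Types (x y lam : R) (a : nat -> bool).

Lemma expansion_homo x y a : 0 < x -> x <= y -> y < 1 ->
  expansion x a <= expansion y a.
Proof.
move=> x0 xy y1.
have cx := expansion_cvg x x0 (le_lt_trans xy y1) a.
have cy := expansion_cvg y (lt_le_trans x0 xy) y1 a.
apply: (ler_cvg_to cx cy); apply: nearW => n; apply: ler_sum => i _.
by rewrite ler_wpM2l// lerXn2r// nnegrE ltW// (lt_le_trans x0).
Qed.

Lemma expansion_ltr x y a : a 0%N -> 0 < x -> x < y -> y < 1 ->
  expansion x a < expansion y a.
Proof.
move=> a0 x0 xy y1; have y0 := lt_trans x0 xy; have x1 := lt_trans xy y1.
rewrite (expansion_rec x)// (expansion_rec y)// a0 !mul1r ltr_leD//.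
apply: ler_pM; [exact: ltW|exact: expansion_ge0|exact: ltW|].
by apply: expansion_homo => //; exact: ltW.
Qed.

(* By monotonicity of the expansion with complementary digits. *)
Lemma expansion_diff x y a : 0 < x -> x <= y -> y < 1 ->
  expansion y a - expansion x a <= y / (1 - y) - x / (1 - x).
Proof.
move=> x0 xy y1; have := expansion_homo _ _ (flip a) x0 xy y1.
rewrite !expansion_flip//; lra.
Qed.

(** The increment of the expansion lies between 0 and that of [y / (1 - y)]. *)
Lemma expansion_continuous x a : 0 < x < 1 ->
  {for x, continuous (fun y => expansion y a)}.
Proof.
move=> /andP[x0 x1]; have cont : (fun y : R => y / (1 - y)) @ x --> x / (1 - x).
  apply: cvgM; first exact: cvg_id.
  apply: cvgV; first by rewrite gt_eqF// subr_gt0.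
  by apply: cvgB; [exact: cvg_cst|exact: cvg_id].
apply/cvgrPdist_lt => e e0; move/cvgrPdist_lt : cont => /(_ e e0).
have x01 : x \in `]0, 1[ by rewrite in_itv/= x0.
move: (near_in_itvoo x01); apply: filterS2 => y; rewrite in_itv => /andP[y0 y1].
case: (leP x y) => xy.
  have := expansion_diff _ _ a x0 xy y1; have := expansion_homo _ _ a x0 xy y1.
  by move=> h1 h2 h3; apply: le_lt_trans h3; rewrite distrC ger0_norm ?subr_ge0// distrC (le_trans h2)// ler_norm.
have := expansion_diff _ _ a y0 (ltW xy) x1; have := expansion_homo _ _ a y0 (ltW xy) x1.
by move=> h1 h2 h3; apply: le_lt_trans h3; rewrite ger0_norm ?subr_ge0// (le_trans h2)// ler_norm.
Qed.

End monotonicity.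

Section komornik_loreti.
Context {R : realType}.
Implicit Types lam x : R.

(** As [thue_morse] starts with 0, the defining equation of [beta_c] at [lam^-1] reads
    [expansion lam tm1 = 1]. *)
Let tm1 := tail 1 thue_morse.

Lemma expansion_thue_morse lam : 0 < lam -> lam < 1 ->
  expansion lam thue_morse = lam * expansion lam tm1.
Proof.
by move=> l0 l1; rewrite expansion_rec// thue_morse0 mul0r add0r.
Qed.

Lemma thue_morse_series lam (l : R) :
  (series (fun n => (thue_morse n)%:R * lam ^+ n) @ \oo --> l) =
  (partial lam tm1 @ \oo --> l).
Proof.
rewrite -cvg_shiftS; set f := (X in X @ _ --> _); have -> // : f = partial lam tm1.
apply/funext => n; rewrite /f /series/= big_nat_recl//= thue_morse0 mul0r add0r.
by apply: eq_bigr => i _; rewrite /tm1 /tail add1n.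
Qed.

Lemma beta_c_exists : exists2 lam : R, 2^-1 <= lam < 1 & expansion lam tm1 = 1.
Proof.
have h0 : 0 < 2^-1 :> R by lra.
have h1 : 2^-1 < 1 :> R by lra.
have q0 : 0 < 3 / 4 :> R by lra.
have q1 : 3 / 4 < 1 :> R by lra.
have hq : 2^-1 <= 3 / 4 :> R by lra.
have lo : expansion (2^-1 : R) tm1 <= 1.
  apply: (le_trans (expansion_le _ h0 h1 _)).
  by have -> : 2^-1 / (1 - 2^-1) = 1 :> R by field.
have hi : 1 <= expansion (3 / 4 : R) tm1.
  have [t1 t2 _ _ _] := tm_values.
  rewrite (expansion_split _ q0 q1 _ 2) !partialS /tm1 /tail t1 t2.
  have := expansion_ge0 _ q0 q1 (tail 2 (tail 1 thue_morse)).
  rewrite /partial big_nil /= !mul1r add0r; set z := expansion _ _ => z0.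
  have : 0 <= (3 / 4) ^+ 2 * z by rewrite mulr_ge0// exprn_ge0// ltW.
  rewrite expr1; lra.
have [||c] := @IVT R (fun x => expansion x tm1) 2^-1 (3 / 4) 1 hq.
- apply: continuous_in_subspaceT => x; rewrite inE/= in_itv/= => /andP[x1 x2].
  by apply: expansion_continuous; apply/andP; split; lra.
- by rewrite ge_min lo le_max hi orbT.
rewrite in_itv/= => /andP[c1 c2] ec; exists c => //; apply/andP; split; lra.
Qed.

(** Of the value chosen by [xget] one only knows that it is a positive solution, so it is located
    through the equation: if its inverse were at least 1, two terms would already sum to 2; if it
    were below 1/2, the sum would be below 1. *)
Lemma beta_cP : 2^-1 <= (beta_c R)^-1 < 1 /\ expansion (beta_c R)^-1 tm1 = 1.
Proof.
have [] : [set x : R | 0 < x /\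
    series (fun n => (thue_morse n)%:R * x ^- n) @ \oo --> (1 : R)] (beta_c R).
  apply: xgetPex; have [lam /andP[l2 l1] el] := beta_c_exists.
  have l0 : 0 < lam by apply: lt_le_trans l2; lra.
  exists lam^-1; split; first by rewrite invr_gt0.
  have -> : (fun n => (thue_morse n)%:R * lam^-1 ^- n) =
      (fun n => (thue_morse n)%:R * lam ^+ n).
    by apply/funext => n; rewrite exprVn invrK.
  by rewrite thue_morse_series -el; exact: expansion_cvg.
set b := beta_c R => b0; set l := b^-1.
have l0 : 0 < l by rewrite invr_gt0.
have -> : (fun n => (thue_morse n)%:R * b ^- n) =
    (fun n => (thue_morse n)%:R * l ^+ n).
  by apply/funext => n; rewrite exprVn.
rewrite thue_morse_series => cl; have l1 : l < 1.
  rewrite ltNge; apply/negP => l1.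
  suff : 2 <= limn (partial l tm1) by rewrite (cvg_lim _ cl)//; lra.
  apply: (limr_ge (cvgP _ cl)).
  exists 2%N => //= n n2; have [t1 t2 _ _ _] := tm_values.
  rewrite /partial (big_cat_nat (leq0n 2) n2)//= -/(partial l tm1 2) !partialS.
  rewrite /partial big_nil /tm1 /tail t1 t2.
  have : 0 <= \sum_(2 <= i < n) (tm1 i)%:R * l ^+ i.+1.
    by apply: sumr_ge0 => i _; rewrite mulr_ge0// exprn_ge0// ltW.
  have : 1 <= l ^+ 2 by rewrite exprn_ege1.
  rewrite /tm1 /tail !mul1r add0r expr1; set S := \sum_(_ <= _ < _) _; move: l1. lra.
have el : expansion l tm1 = 1 by exact: cvg_lim cl.
split => //; rewrite l1 andbT leNgt; apply/negP => l2.
have t1 : tm1 0%N by have [] := tm_values.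
have h1 : 2^-1 < 1 :> R by lra.
have := expansion_ltr _ _ _ t1 l0 l2 h1; rewrite el.
have := expansion_le _ (lt_trans l0 l2) h1 tm1.
have -> : 2^-1 / (1 - 2^-1) = 1 :> R by field.
lra.
Qed.

(** The value is [lam] times [expansion lam tm1], which increases strictly in [lam] and equals 1 at
    the critical parameter. *)
Lemma thue_morse_below lam : 0 < lam < (beta_c R)^-1 ->
  expansion lam thue_morse < lam.
Proof.
have [/andP[b2 b1] eb] := beta_cP; move=> /andP[l0 lb].
have t1 : tm1 0%N by have [] := tm_values.
rewrite expansion_thue_morse ?(lt_trans lb)// gtr_pMr// -eb.
exact: expansion_ltr.
Qed.

Lemma thue_morse_above lam : (beta_c R)^-1 < lam < 1 ->
  lam < expansion lam thue_morse.
Proof.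
have [/andP[b2 b1] eb] := beta_cP; move=> /andP[lb l1].
have b0 : 0 < (beta_c R)^-1 by apply: lt_le_trans b2; lra.
have l0 := lt_trans b0 lb.
have t1 : tm1 0%N by have [] := tm_values.
by rewrite expansion_thue_morse// ltr_pMr// -eb; exact: expansion_ltr.
Qed.

End komornik_loreti.

(** * Countability above the critical value *)

Lemma lexle_zero_cons a b : lexle a b -> lexle (zero_cons a) (zero_cons b).
Proof.
by move=> ab [//|k] H; apply: ab => j jk; exact: (H j.+1).
Qed.

Lemma zero_cons_tail a : a 0%N = false -> zero_cons (tail 1 a) = a.
Proof. by move=> a0; apply/funext => -[//|n]; rewrite /= /tail add1n. Qed.

Section countability.
Context {R : realType}.
Implicit Types (lam d x : R) (a : nat -> bool).

Lemma golden_root lam : 0 < lam < golden -> lam ^+ 2 + lam < 1.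
Proof.
move=> /andP[l0]; rewrite /golden => lg.
have h : 0 <= Num.sqrt 5 :> R by exact: sqrtr_ge0.
have h2 : Num.sqrt 5 ^+ 2 = 5 :> R by rewrite sqr_sqrtr.
nra.
Qed.

Lemma golden_lt1 lam : 2^-1 < lam < golden -> 0 < lam < 1.
Proof.
move=> /andP[l2 lg]; have l0 : 0 < lam by lra.
have := golden_root lam; rewrite l0 lg => /(_ isT); nra.
Qed.

(* All tails lie below the greedy expansion of 1, which is itself strictly
   below the Thue-Morse sequence: otherwise [lexle_expansion] would bound the
   value of the latter by [lam]. *)
Lemma gap_tm_below lam : (beta_c R)^-1 < lam < 1 ->
  exists n, forall d a, 0 < d -> gap lam d a -> tm_below (2 ^ n) a.
Proof.
move=> /[dup] lbeta /andP[lb l1]; have [/andP[b2 b1] _] := @beta_cP R.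
have l2 : 2^-1 <= lam := le_trans b2 (ltW lb).
have l0 : 0 < lam by apply: lt_le_trans l2; lra.
have I1 : 0 <= (1 : R) <= lam / (1 - lam).
  by rewrite ler01/= ler_pdivlMr; lra.
(* The leading 0 turns the expansion of 1 into one of [lam], the threshold in [lexle_expansion]. *)
pose G := zero_cons (greedy lam 1).
have EG : expansion lam G = lam.
  rewrite expansion_rec// mul0r add0r.
  have -> : tail 1 G = greedy lam 1 by apply/funext => j; rewrite /tail add1n.
  by rewrite expansion_greedy// mulr1.
have : ~ lexle thue_morse G.
  move=> tG; have := lexle_expansion _ l0 l1 thue_morse G erefl
    (fun i => lexle_trans _ _ _ (rtail_thue_morse i) tG).
  rewrite EG => /(_ (lexx _) 0%N); apply/negP; rewrite -ltNge.
  by rewrite expansion_rtail// thue_morse0 tail0; exact: thue_morse_above.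
(* At [k] the Thue-Morse sequence first exceeds [G]. Every [rtail a i] is at most [G], so it has
   dropped below Thue-Morse by index [k], independently of [d] and [a]. *)
move=> /existsNP[k /not_implyP[tGk /negP]]; rewrite negb_imply => /andP[tk /negPf Gk].
exists k => d a d0 ga i.
have k2 : (k <= 2 ^ k)%N by rewrite ltnW// ltn_expl.
have rG : lexle (rtail a i) G.
  rewrite -(zero_cons_tail (rtail a i)) ?rtail0//; apply: lexle_zero_cons.
  apply: lexle_greedy => //; have := ga i.
  rewrite expansion_rec// rtail0 mul0r add0r => h.
  by rewrite -(ltr_pM2l l0) mulr1; lra.
have [agree|] := pselect (forall j, (j < k)%N -> rtail a i j = thue_morse j).
  exists k; split => //.
  by have := rG k; rewrite Gk implybF => H; apply/negbTE/H => j jk; rewrite agree// tGk.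
move=> /existsNP[m /not_implyP[mk /eqP nm]].
have ex : exists m, rtail a i m != thue_morse m by exists m.
case: (ex_minnP ex) => j nj jmin.
have jk : (j < k)%N := leq_ltn_trans (jmin _ nm) mk.
have below l : (l < j)%N -> rtail a i l = thue_morse l.
  by move=> lj; apply/eqP/negPn/negP => /jmin; rewrite leqNgt lj.
have := rG j (fun l lj => etrans (below l lj) (tGk l (ltn_trans lj jk))).
rewrite -tGk// => imp; exists j; split => //.
- by rewrite (leq_trans (ltnW jk)).
- by move: nj imp; case: (rtail a i j); case: (thue_morse j).
- by move: nj imp; case: (rtail a i j); case: (thue_morse j).
Qed.

Lemma Atilde_expansion lam x : 0 < lam < 1 -> 2^-1 < lam -> Atilde lam x ->
  exists a d, [/\ x = expansion lam a, 0 < d & gap lam d a].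
Proof.
move=> /andP[l0 l1] l2 [d /= d0 xd]; have [[_ [a [xa _]]] _] := xd.
by exists a, d; split => //; apply: Atilde_delta_gap => //; rewrite -xa.
Qed.

Lemma gap_Atilde lam d a : 0 < lam < 1 -> 0 < d -> gap lam d a ->
  Atilde lam (expansion lam a).
Proof.
by move=> /andP[l0 l1] d0 ga; exists d => //; exact: gap_Atilde_delta.
Qed.

Lemma countable_Atilde lam : (beta_c R)^-1 < lam < 1 -> countable (Atilde lam).
Proof.
move=> /[dup] /gap_tm_below[n Hn] /andP[lb l1].
have [/andP[b2 _] _] := @beta_cP R.
have l2 := le_lt_trans b2 lb.
have l01 : 0 < lam < 1 by rewrite l1 andbT; apply: lt_trans l2; lra.
apply: (@sub_countable _ _ _ (expansion lam @` tm_below (2 ^ n))).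
  apply: subset_card_le => x /(Atilde_expansion _ _ l01 l2)[a [d [-> d0 ga]]].
  by exists a => //; exact: Hn ga.
exact: sub_countable (card_image_le _ _) (countable_tm_below n).
Qed.

(** [k] zeros followed by 010101...; these sequences provide infinitely many points. *)
Definition delayed (k : nat) : nat -> bool := fun j => (k <= j)%N && odd (j - k).

(** From [k] on the digits alternate; before [k] each 0 is followed by another 0, so the tail is
    below 0101... at index 1. *)
Lemma rtail_delayed k i : lexle (rtail (delayed k) i) odd.
Proof.
case: (leqP k i) => ki.
  have -> : rtail (delayed k) i = odd; last by move=> j _; exact: implybb.
  apply/funext => j; rewrite /rtail /delayed ki (leq_trans ki (leq_addr _ _))/=.
  by rewrite -addnBAC// oddD addbAC addbb.
move=> [|[|j]] H; rewrite ?rtail0//= ?implybT//.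
have := H 1%N isT; rewrite /rtail /delayed (leqNgt k i) ki/= addbF addn1.
by rewrite leq_eqVlt [(k < i.+1)%N]ltnNge ki orbF => /andP[/eqP ->]; rewrite subnn.
Qed.

Lemma expansion_odd lam : 0 < lam < 1 ->
  expansion lam odd = lam ^+ 2 / (1 - lam ^+ 2).
Proof.
move=> /andP[l0 l1]; have l2 : 0 < 1 - lam ^+ 2 by nra.
have w0 : 0 <= lam ^+ 2 / (1 - lam ^+ 2) by rewrite divr_ge0 ?exprn_ge0// ltW.
have w1 : 0 <= lam / (1 - lam ^+ 2) by rewrite divr_ge0// ltW.
apply: (expansion_unique _ l0 l1 _ (fun n => if odd n then lam / (1 - lam ^+ 2)
  else lam ^+ 2 / (1 - lam ^+ 2))
  (lam / (1 - lam ^+ 2) + lam ^+ 2 / (1 - lam ^+ 2))) => n.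
  by case: ifP => _; rewrite ger0_norm//; lra.
by rewrite /=; case: (odd n) => /=; field; rewrite gt_eqF.
Qed.

Lemma infinite_Atilde lam : 2^-1 < lam < golden -> infinite_set (Atilde lam).
Proof.
move=> /[dup] /golden_lt1 l01 /andP[l2 lg]; have /andP[l0 l1] := l01.
have l3 := golden_root lam; rewrite l0 lg in l3; have {}l3 := l3 isT.
pose d := lam - expansion lam odd.
(* The golden ratio enters here: 0101... has value below [lam] exactly when [lam ^+ 2 + lam < 1]. *)
have d0 : 0 < d.
  rewrite subr_gt0 expansion_odd// ltr_pdivrMr; last by nra.
  by rewrite expr2 ltr_pM2l//; nra.
have gd k : gap lam d (delayed k).
  move=> i; rewrite /d opprB addrC subrK; apply: lexle_expansion => //.
    by move=> j; exact: rtail_delayed.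
  by rewrite /d in d0; lra.
have inj : injective (fun k => expansion lam (delayed k)).
  have lt k l : (k < l)%N -> delayed k <> delayed l.
    move=> kl /(congr1 (fun a => a k.+1)); rewrite /delayed leqnSn subSnn /=.
    by rewrite leq_eqVlt ltnNge kl orbF; case: eqP => [->|//]; rewrite subnn.
  move=> k l /(gap_inj _ l0 l1 _ _ _ d0 (gd k)) kl.
  by case: (ltngtP k l) => // h; [case: (lt _ _ h kl)|case: (lt _ _ h (esym kl))].
apply/infiniteP; pose f k := expansion lam (delayed k).
apply: (@card_le_trans _ _ _ (f @` setT)).
  have : (f @` setT #= [set: nat])%card by apply: inj_card_eq => k l _ _; exact: inj.
  by rewrite card_eq_le => /andP[].
by apply: subset_card_le => _ [k _ <-]; exact: gap_Atilde (gd k).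
Qed.

End countability.

(** * Hausdorff measure *)

Section hausdorff.
Context {R : realType}.
Implicit Types (A U : set R) (s e C : R).

Lemma le_diam U x y : U x -> U y -> (`|x - y|%:E <= diam U)%E.
Proof. by move=> Ux Uy; apply: ereal_sup_ubound; exists (x, y). Qed.

Lemma diam_le U e : (forall x y, U x -> U y -> `|x - y| <= e) ->
  (diam U <= e%:E)%E.
Proof.
by move=> H; apply: ge_ereal_sup => _ [[x y] [/= Ux Uy] <-]; rewrite lee_fin H.
Qed.

Lemma diam_pow_ge0 s U : (0 <= diam_pow s U)%E.
Proof. by rewrite /diam_pow; case: ifP => // _; exact: poweR_ge0. Qed.

Lemma le_diam_pow s U x y : 0 <= s -> U x -> U y ->
  ((`|x - y| `^ s)%:E <= diam_pow s U)%E.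
Proof.
move=> s0 Ux Uy; rewrite /diam_pow; case: ifPn => [/asboolP U0|_].
  by rewrite U0 in Ux.
rewrite -poweR_EFin; apply: gt0_ler_poweR => //; last exact: le_diam.
  by rewrite in_itv/= lee_fin normr_ge0 leey.
by rewrite in_itv/= leey andbT (le_trans _ (le_diam _ _ _ Ux Uy))// lee_fin.
Qed.

Lemma hausdorff_measure_cover s A e : hausdorff_measure s A = 0%E -> 0 < e ->
  exists2 U : nat -> set R, A `<=` \bigcup_i U i &
    (\sum_(0 <= i <oo) diam_pow s (U i) < e%:E)%E.
Proof.
move=> HA e0; have : (hausdorff_content s 1 A < e%:E)%E.
  apply: (@le_lt_trans _ _ 0%E); last by rewrite lte_fin.
  by rewrite -HA; apply: ereal_sup_ubound; exists 1 => //=.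
by move=> /ereal_inf_lt[_ [U [AU _] <-] ?]; exists U.
Qed.

(* Mass distribution through a Hoelder map onto the unit interval: a cover of
   the points [X b] induces a cover of [0, 1] by intervals of lengths
   comparable to the s-th powers of the diameters. *)
Lemma hausdorff_measure_holder (I : Type) (X phi : I -> R) s C A :
  0 <= s -> 0 < C -> (forall b, A (X b)) ->
  (forall y, 0 <= y <= 1 -> exists b, phi b = y) ->
  (forall b b', `|phi b - phi b'| <= C * `|X b - X b'| `^ s) ->
  hausdorff_measure s A <> 0%E.
Proof.
move=> s0 C0 AX surj hol HA.
(* The covering intervals have length at most [2 * C] times the terms of the sum, hence total length
   below 1/2. *)
have e0 : 0 < (4 * C)^-1 by rewrite invr_gt0 mulr_gt0.
have [U AU sumU] := hausdorff_measure_cover s A _ HA e0.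
have Dfin i : diam_pow s (U i) \is a fin_num.
  rewrite ge0_fin_numE ?diam_pow_ge0//.
  have := nneseries_lim_ge (u_ := fun i => diam_pow s (U i)) (P := xpredT) (m := 0) i.+1
    (fun n _ _ => diam_pow_ge0 s (U n)).
  move=> /le_lt_trans/(_ sumU); rewrite big_nat_recr//= => h.
  apply: le_lt_trans (lt_trans h (ltry _)); rewrite leeDr//.
  by apply: sume_ge0 => j _; exact: diam_pow_ge0.
pose d i := fine (diam_pow s (U i)).
have d0 i : 0 <= d i by apply: fine_ge0; exact: diam_pow_ge0.
(* The centre [J i] is the value of [phi] at one parameter whose point lies in [U i], or 0 if there
   is none. *)
have /choice[J HJ] : forall i, exists y : R, forall b, U i (X b) ->
    phi b \in `[y - C * d i, y + C * d i].
  move=> i; have [[b0 Ub0]|nob] := pselect (exists b, U i (X b)); last first.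
    by exists 0 => b Ub; case: nob; exists b.
  exists (phi b0) => b Ub; rewrite in_itv/= -ler_distlC.
  apply: (le_trans (hol b0 b)).
  by rewrite ler_pM2l// -lee_fin fineK//; exact: le_diam_pow.
pose F i : set R := [set` `[J i - C * d i, J i + C * d i]].
have cov : [set` `[0 : R, 1]] `<=` \bigcup_i F i.
  move=> y; rewrite /= in_itv/= => /surj[b <-].
  by have [i _ Ui] := AU _ (AX b); exists i => //; exact: HJ.
have : (lebesgue_measure [set` `[0%R : R, 1%R]] <= \sum_(0 <= i <oo) lebesgue_measure (F i))%E.
  apply: measure_sigma_subadditive => //; first by move=> i; exact: measurable_itv.
rewrite lebesgue_measure_itv/= lte_fin ltr01 oppr0 adde0.
apply/negP; rewrite -ltNge.
apply: (@le_lt_trans _ _ (\sum_(0 <= i <oo) ((2 * C)%:E * diam_pow s (U i)))%E).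
  apply: lee_nneseries => // i _; rewrite lebesgue_measure_itv/=.
  case: ifPn => _; last by rewrite mule_ge0 ?diam_pow_ge0// lee_fin mulr_ge0// ltW.
  by rewrite -(fineK (Dfin i)) -EFinB -EFinM lee_fin /d; lra.
rewrite nneseriesZl; last by move=> i _; exact: diam_pow_ge0.
have C2 : 0 < 2 * C by rewrite mulr_gt0.
apply: (@lt_trans _ _ ((2 * C)%:E * ((4 * C)^-1)%:E)%E).
  by rewrite lte_pmul2l// lte_fin.
have -> : ((2 * C)%:E * ((4 * C)^-1)%:E = (2^-1)%:E)%E.
  by rewrite -EFinM; congr (_%:E); field; rewrite gt_eqF.
by rewrite lte_fin; lra.
Qed.

Lemma hausdorff_dim_ge A s0 :
  (forall s, 0 <= s < s0 -> hausdorff_measure s A <> 0%E) ->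
  (s0%:E <= hausdorff_dim A)%E.
Proof.
move=> H; apply/ereal_infP => _ [s [s_ge0 Hs] <-]; rewrite lee_fin leNgt.
by apply/negP => ss0; apply: (H s) => //; rewrite s_ge0.
Qed.

(** A cover by [N] equal intervals has sum [D] times the power [s - 1] of [D / N], which is small
    for large [N]. *)
Lemma hausdorff_measure_bounded s A (D : R) : 1 < s -> 0 < D ->
  A `<=` [set` `[0, D[] -> hausdorff_measure s A = 0%E.
Proof.
move=> s1 D0 AD; have s0 : 0 < s := lt_trans ltr01 s1.
apply/eqP; rewrite eq_le; apply/andP; split; last first.
  apply: (@le_trans _ _ (hausdorff_content s 1 A)).
    apply/ereal_infP => _ [U _ <-].
    by apply: nneseries_ge0 => n _ _; exact: diam_pow_ge0.
  by apply: ereal_sup_ubound; exists 1 => //=.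
apply: ge_ereal_sup => _ [delta /= delta0 <-].
apply/lee_addgt0Pr => e e0; rewrite add0e.
pose eta := Num.min delta ((e / D) `^ (s - 1)^-1).
have eta0 : 0 < eta by rewrite lt_min delta0 powR_gt0// divr_gt0.
pose N := (Num.truncn (D / eta)).+1.
have NR : D / eta < N%:R by exact: truncnS_gt.
have N0 : 0 < N%:R :> R by rewrite ltr0n.
have DN : D / N%:R < eta by rewrite ltr_pdivrMr// mulrC -ltr_pdivrMr.
have DN0 : 0 < D / N%:R by rewrite divr_gt0.
have DNe : (D / N%:R) `^ s *+ N <= e.
  have -> : (D / N%:R) `^ s *+ N = D * (D / N%:R) `^ (s - 1).
    rewrite -(mulr_powRB1 (ltW DN0) s0) -mulr_natr; field; exact: lt0r_neq0.
  rewrite mulrC -ler_pdivlMr//.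
  have -> : e / D = ((e / D) `^ (s - 1)^-1) `^ (s - 1).
    by rewrite -powRrM mulVf ?powRr1 ?divr_ge0 ?ltW// lt0r_neq0// subr_gt0.
  apply: ge0_ler_powR; rewrite ?nnegrE ?powR_ge0 ?subr_ge0 ?ltW//.
  by rewrite (lt_le_trans DN)// ge_min lexx orbT.
pose U i : set R := if (i < N)%N then
  [set` `[D / N%:R * i%:R, D / N%:R * i.+1%:R]] else set0.
have dU i : (diam (U i) <= (D / N%:R)%:E)%E.
  apply: diam_le => x y; rewrite /U; case: ifP => // _ /=.
  rewrite !in_itv/= -addn1 natrD mulrDr mulr1 => /andP[x1 x2] /andP[y1 y2].
  by rewrite ler_norml; apply/andP; split; lra.
apply: ge_ereal_inf; exists (\sum_(0 <= i <oo) diam_pow s (U i))%E.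
  exists U => //; split; last first.
    move=> i; apply: (le_trans (dU i)); rewrite lee_fin ltW// (lt_le_trans DN)//.
    by rewrite ge_min lexx.
  move=> x /AD /=; rewrite in_itv/= => /andP[x0 xD].
  have q0 : 0 <= x / (D / N%:R) by rewrite divr_ge0// ltW.
  have /andP[q1 q2] := truncn_itv q0.
  exists (Num.truncn (x / (D / N%:R))) => //.
  rewrite /U truncn_lt_nat// ltr_pdivrMr// mulrCA divff ?lt0r_neq0// mulr1 xD /=.
  by rewrite in_itv/= ![D / N%:R * _]mulrC -ler_pdivlMr// q1 -ler_pdivrMr// ltW.
apply: lime_le; first by apply: is_cvg_nneseries => n _ _; exact: diam_pow_ge0.
(* The sets are empty from index [N] on, and [diam_pow] counts the empty set as 0, so at most [N]
   terms contribute. *)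
apply: nearW => n; apply: (@le_trans _ _ ((D / N%:R) `^ s *+ minn n N)%:E); last first.
  by rewrite lee_fin (le_trans _ DNe)// ler_wpMn2l ?powR_ge0// geq_minr.
elim: n => [|n IHn]; first by rewrite big_nil min0n.
rewrite big_nat_recr//=; case: (ltnP n N) => nN.
  rewrite (minn_idPl nN) mulrSr EFinD leeD//; first by move: IHn; rewrite (minn_idPl (ltnW nN)).
  rewrite /diam_pow; case: ifPn => [_|/asboolPn Un0].
    by rewrite lee_fin powR_ge0.
  have [x Ux] : U n !=set0 by apply/set0P/eqP.
  rewrite -poweR_EFin; apply: gt0_ler_poweR; [exact: ltW| | |exact: dU].
    by rewrite in_itv/= leey andbT (le_trans _ (le_diam _ _ _ Ux Ux))// lee_fin.
  by rewrite in_itv/= leey andbT lee_fin ltW.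
move: IHn; rewrite (minn_idPr (leqW nN)) (minn_idPr nN) {3}/diam_pow ifT ?adde0//.
by apply/asboolP; rewrite /U ltnNge nN.
Qed.

End hausdorff.

(** * Hausdorff dimension of the avoiding set *)

Section dimension_bounds.
Context {R : realType}.
Implicit Types (lam d s : R) (a b : nat -> bool).

Lemma hausdorff_dim_Atilde_le1 lam : 0 < lam < 1 ->
  (hausdorff_dim (Atilde lam) <= 1%:E)%E.
Proof.
move=> /andP[l0 l1]; apply/lee_addgt0Pr => e e0; apply: ereal_inf_lbound.
exists (1 + e) => //; split; first by lra.
have w0 : 0 <= lam / (1 - lam) by rewrite divr_ge0// ltW// subr_gt0.
(* The added 1 places the closed interval inside a half-open one. *)
apply: (hausdorff_measure_bounded _ _ (lam / (1 - lam) + 1)); [lra|lra|].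
move=> x [d _ [[/andP[x0 x1] _] _]]; rewrite /= in_itv/= x0/=; lra.
Qed.

Lemma powRX (x s : R) n : 0 <= x -> (x ^+ n) `^ s = (x `^ s) ^+ n.
Proof.
move=> x0; elim: n => [|n IHn]; first by rewrite !expr0 powR1.
by rewrite !exprS powRM ?exprn_ge0// IHn.
Qed.

(** Every [L] digits of the code carry [p] free digits. Sending the coded point to the binary value
    of the free digits is Hoelder for each exponent below the stated bound, by comparing the first
    differences before and after coding. *)
Lemma hausdorff_dim_coding lam d p L (E : (nat -> bool) -> (nat -> bool)) :
  0 < lam < 1 -> 0 < d -> (0 < p)%N -> (0 < L)%N ->
  (forall b, gap lam d (E b)) ->
  (forall k b b', (forall i, (i < L * k)%N -> E b i = E b' i) ->
     forall i, (i < p * k)%N -> b i = b' i) ->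
  ((p%:R * ln 2 / (L%:R * `|ln lam|))%:E <= hausdorff_dim (Atilde lam))%E.
Proof.
move=> l01 d0 p0 L0 gE coding; have /andP[l0 l1] := l01.
have lnl : ln lam < 0 by exact: ln_lt0.
apply: hausdorff_dim_ge => s /andP[s0 slt].
have L0R : 0 < L%:R :> R by rewrite ltr0n.
pose q := (lam ^+ L) `^ s.
have q0 : 0 < q by rewrite powR_gt0// exprn_gt0.
have h0 : 0 < 2^-1 :> R by lra.
have h1 : 2^-1 < 1 :> R by lra.
have pq : 2^-1 ^+ p <= q.
  rewrite -ler_ln ?posrE ?exprn_gt0// ln_powR !lnXn// lnV ?posrE//.
  move: slt; rewrite ltr_pdivlMr; last by rewrite mulr_gt0// normr_gt0 lt_eqF.
  rewrite ltr0_norm// => h; rewrite -[- ln 2 *+ p]mulr_natl -[ln lam *+ L]mulr_natl mulrN lerNl -!mulrN; exact: ltW.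
have ds0 : 0 < d `^ s by exact: powR_gt0.
(* The factor [q] pays for passing from [k.+1] blocks to [k]; the power of [d] comes from
   [gap_dist]. *)
pose C := (q * d `^ s)^-1.
have C0 : 0 < C by rewrite invr_gt0 mulr_gt0.
apply: (hausdorff_measure_holder _ (fun b => expansion lam (E b))
    (fun b => expansion (2^-1) b) _ C _ s0 C0).
- by move=> b; exact: gap_Atilde (gE b).
(* In base 2 the greedy expansions reach all of the unit interval. *)
- move=> y y01; exists (greedy 2^-1 y); apply: expansion_greedy => //.
  by have -> : 2^-1 / (1 - 2^-1) = 1 :> R by field.
move=> b b'; have [->|/ex_first_diff[j [bj nj]]] := pselect (b = b').
  by rewrite !subrr !normr0 mulr_ge0 ?powR_ge0// ltW.
pose k := (j %/ p)%N.
have /existsNP[i /not_implyP[iL /eqP nE]] :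
    ~ (forall i, (i < L * k.+1)%N -> E b i = E b' i).
  move=> /coding /(_ j); rewrite mulnC ltn_ceil// => /(_ isT) e.
  by rewrite e eqxx in nj.
have ex : exists i, E b i != E b' i by exists i.
case: (ex_minnP ex) => n nn nmin.
have nL : (n <= L * k.+1)%N by rewrite (leq_trans (nmin _ nE))// ltnW.
have below l : (l < n)%N -> E b l = E b' l.
  by move=> ln; apply/eqP/negPn/negP => /nmin; rewrite leqNgt ln.
have lo := gap_dist _ l0 l1 _ _ _ _ (gE b) below nn.
have hi := dist_expansion _ h0 h1 _ _ _ bj.
have e1 : 2^-1 / (1 - 2^-1) = 1 :> R by field.
rewrite e1 mulr1 in hi.
apply: (le_trans hi).
have hk : 2^-1 ^+ j <= q ^+ k.
  apply: (@le_trans _ _ ((2^-1 ^+ p) ^+ k)).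
    by rewrite -exprM ler_wiXn2l ?ltW// mulnC leq_divM.
  by apply: lerXn2r => //; rewrite ?nnegrE ?exprn_ge0// ltW.
apply: (le_trans hk).
rewrite /C ler_pdivlMl ?mulr_gt0// mulrC mulrA -exprSr.
apply: (@le_trans _ _ ((lam ^+ n * d) `^ s)); last first.
  by apply: ge0_ler_powR; rewrite ?nnegrE ?mulr_ge0 ?exprn_ge0 ?(ltW d0) ?(ltW l0).
rewrite powRM ?(ltW d0) ?exprn_ge0 ?(ltW l0)// ler_pM2r//.
rewrite -powRX ?exprn_ge0 ?(ltW l0)// -exprM.
apply: ge0_ler_powR; rewrite ?nnegrE ?exprn_ge0 ?(ltW l0)//.
by rewrite ler_wiXn2l ?(ltW l0) ?(ltW l1).
Qed.

(** * Positive dimension below the critical parameter *)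

Lemma iter_theta_mul m b i : iter m theta b (2 ^ m * i)%N = b i.
Proof.
elim: m i => [|m IHm] i; first by rewrite mul1n.
by rewrite expnS -mulnA mul2n iterS /theta doubleK odd_double addbF IHm.
Qed.

Lemma hausdorff_dim_gt0 lam : 0 < lam < (beta_c R)^-1 ->
  (0 < hausdorff_dim (Atilde lam))%E.
Proof.
move=> lb; have [/andP[_ b1] _] := @beta_cP R.
have tm := thue_morse_below _ lb.
have /andP[l0 lbeta] := lb; have l1 := lt_trans lbeta b1.
have dt : 0 < lam - expansion lam thue_morse by rewrite subr_gt0.
(* [G] below shares [2 ^ m] digits with the Thue-Morse sequence, so this [m] keeps its value below
   [lam]. *)
have [m Hm] := expr_small _ l0 l1 (lam / (1 - lam)) _ dt.
pose G := iter m theta lead_zero_ones.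
have Glam : expansion lam G < lam.
  have := dist_expansion _ l0 l1 G thue_morse (2 ^ m)%N
    (fun j jm => iter_theta_thue_morse m lead_zero_ones j erefl jm).
  have : lam ^+ (2 ^ m) * (lam / (1 - lam)) <= lam ^+ m * (lam / (1 - lam)).
    rewrite ler_wpM2r ?divr_ge0 ?subr_ge0 ?(ltW l0) ?(ltW l1)//.
    by rewrite ler_wiXn2l ?(ltW l0) ?(ltW l1)// ltnW// ltn_expl.
  have := ler_norm (expansion lam G - expansion lam thue_morse); lra.
have G0 : G 0%N = false by rewrite /G iter_theta_thue_morse ?thue_morse0 ?expn_gt0.
pose d := lam - expansion lam G.
have d0 : 0 < d by rewrite subr_gt0.
have l01 : 0 < lam < 1 by rewrite l0.
apply: (lt_le_trans _ (hausdorff_dim_coding lam d 1 (2 ^ m) (iter m theta) l01 d0 _ _ _ _)) => //.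
- rewrite lte_fin mul1r divr_gt0 ?ln_gt0 ?ltr1n// mulr_gt0 ?ltr0n ?expn_gt0//.
  by rewrite normr_gt0 lt_eqF// ln_lt0.
- by rewrite expn_gt0.
- move=> b i; rewrite /d opprB addrC subrK; apply: lexle_expansion => //; last exact: ltW.
  by move=> j; exact: rtail_iter_theta.
- move=> k b b' H i; rewrite mul1n => ik; rewrite -(iter_theta_mul m b) -(iter_theta_mul m b').
  by apply: H; rewrite ltn_pmul2l// expn_gt0.
Qed.

(* The fixed digits 01 at the end of each block bound the runs of equal
   digits by [p.+2]. *)
Definition blocks (p : nat) (b : nat -> bool) : nat -> bool := fun i =>
  let r := (i %% p.+2)%N in
  if (r < p)%N then b ((i %/ p.+2) * p + r)%N else r == p.+1.

Lemma blocks_repeat p b i : exists j, (0 < j <= p.+2)%N /\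
  blocks p b (i + j) = blocks p b i.
Proof.
(* Within each block, [rho] is the place of the fixed digit equal to the one at [i]; its next
   occurrence is the repetition. *)
pose rho := (if blocks p b i then p.+1 else p)%N.
have Hrho q : blocks p b (q * p.+2 + rho)%N = blocks p b i.
  have rp : (rho < p.+2)%N by rewrite /rho; case: ifP.
  rewrite {1}/blocks modnMDl modn_small// /rho; case: (blocks p b i).
    by rewrite ltnNge leqnSn/= eqxx.
  by rewrite ltnn ltn_eqF.
have ei := divn_eq i p.+2; have := ltn_pmod i (ltn0Sn p.+1).
set q := (i %/ p.+2)%N in ei *; set r := (i %% p.+2)%N in ei * => rp.
have rhop : (rho < p.+2)%N by rewrite /rho; case: ifP.
case: (ltnP r rho) => h.
  exists (rho - r)%N; split; first by apply/andP; split; lia.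
  by rewrite -[RHS](Hrho q); congr blocks; lia.
exists (p.+2 + rho - r)%N; split; first by apply/andP; split; lia.
by rewrite -[RHS](Hrho q.+1); congr blocks; lia.
Qed.

Lemma blocks_coding p k b b' : (forall i, (i < p.+2 * k)%N -> blocks p b i = blocks p b' i) ->
  forall i, (i < p * k)%N -> b i = b' i.
Proof.
case: p => [|p]; first by move=> _ i; rewrite mul0n.
move=> H i ik; have := H ((i %/ p.+1) * p.+3 + i %% p.+1)%N.
have ip := ltn_pmod i (ltn0Sn p).
have ip2 : (i %% p.+1 < p.+3)%N by rewrite (ltn_trans ip).
rewrite /blocks !modnMDl !(modn_small ip2) ip divnMDl// (divn_small ip2) addn0 -divn_eq.
apply; have qk : (i %/ p.+1 < k)%N by rewrite ltn_divLR// mulnC.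
apply: (@leq_trans ((i %/ p.+1).+1 * p.+3)).
  by rewrite mulSn addnC ltn_add2r.
by rewrite mulnC leq_mul2l.
Qed.

Lemma expansion_ge2 lam a j : 0 < lam < 1 -> (0 < j)%N -> a 0%N -> a j ->
  lam + lam ^+ j.+1 <= expansion lam a.
Proof.
move=> /andP[l0 l1]; case: j => // j _ a0 aj.
rewrite expansion_rec// a0 mul1r lerD2l exprS ler_pM2l//.
rewrite (expansion_split _ l0 l1 _ j) tailD add1n exprSr.
rewrite -[leLHS]add0r; apply: lerD.
  by apply: sumr_ge0 => i _; rewrite mulr_ge0// exprn_ge0// ltW.
by rewrite ler_pM2l ?exprn_gt0//; exact: expansion_digit1.
Qed.

(** The complement of a normalized tail has a 1 at index 0 and another at index at most [p.+2],
    hence value at least [lam + lam ^+ p.+3]. *)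
Lemma gap_blocks lam p b : 0 < lam < 1 ->
  gap lam (2 * lam + lam ^+ p.+3 - lam / (1 - lam)) (blocks p b).
Proof.
move=> l01 i; have /andP[l0 l1] := l01.
have [j [/andP[j0 jp] bj]] := blocks_repeat p b i.
have := expansion_ge2 lam (flip (rtail (blocks p b) i)) j l01 j0.
rewrite {1 2}/flip rtail0 /rtail bj addbb => /(_ isT isT).
rewrite expansion_flip//.
have : lam ^+ p.+3 <= lam ^+ j.+1 by rewrite ler_wiXn2l ?ltW.
lra.
Qed.

Lemma hausdorff_dim_blocks lam p : 2^-1 < lam < 1 ->
  0 < 2 * lam + lam ^+ p.+3 - lam / (1 - lam) ->
  ((p%:R / p.+2%:R)%:E <= hausdorff_dim (Atilde lam))%E.
Proof.
case: p => [|p] /andP[l2 l1] d0.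
  by rewrite mul0r; apply/ereal_infP => _ [s [s0 _] <-]; rewrite lee_fin.
have l0 : 0 < lam by lra.
have l01 : 0 < lam < 1 by rewrite l0.
have := hausdorff_dim_coding lam _ p.+1 p.+3 (blocks p.+1) l01 d0 isT isT
  (fun b => gap_blocks lam p.+1 b l01) (blocks_coding p.+1).
apply: le_trans; rewrite lee_fin.
have ll : 0 < `|ln lam| by rewrite normr_gt0 lt_eqF// ln_lt0.
(* Replacing the contraction [lam] by 1/2 only lowers the bound from the coding. *)
have : `|ln lam| <= ln 2.
  rewrite ltr0_norm ?ln_lt0// -lnV ?posrE// ler_ln ?posrE ?invr_gt0//.
  by rewrite invf_ple ?posrE// ltW.
move=> h; rewrite ler_pdivrMr ?ltr0n//.
have -> : p.+1%:R * ln 2 / (p.+3%:R * `|ln lam|) * p.+3%:R =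
    p.+1%:R * (ln 2 / `|ln lam|) :> R.
  by field; rewrite gt_eqF//= pnatr_eq0.
by rewrite ler_peMr// ler_pdivlMr// mul1r.
Qed.

Lemma hausdorff_dim_near (e : R) : 0 < e ->
  \forall lam \near (2^-1 : R)^'+,
    ((1 - e)%:E <= hausdorff_dim (Atilde lam) <= 1%:E)%E.
Proof.
(* This makes [2 / p.+2], the proportion of fixed digits, at most [e]. *)
move=> e0; pose p := (Num.truncn (2 / e)).+1.
have pe : 2 / e < p%:R by exact: truncnS_gt.
have p0 : 0 < p%:R :> R by rewrite ltr0n.
have he : 1 - e <= p%:R / p.+2%:R.
  rewrite ler_pdivlMr ?ltr0n// -addn2 natrD.
  by move: pe; rewrite ltr_pdivrMr// => pe; nra.
have cont : (fun lam : R => 2 * lam + lam ^+ p.+3 - lam / (1 - lam)) @ (2^-1)^'+ -->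
    2 * 2^-1 + 2^-1 ^+ p.+3 - 2^-1 / (1 - 2^-1 : R).
  apply: cvg_at_right_filter.
  apply: cvgB; first apply: cvgD.
  - by apply: cvgM; [exact: cvg_cst|exact: cvg_id].
  - exact: exprn_continuous.
  - apply: cvgM; first exact: cvg_id.
    apply: cvgV; first by rewrite lt0r_neq0//; lra.
    by apply: cvgB; [exact: cvg_cst|exact: cvg_id].
(* At 1/2 the margin of [gap_blocks] equals [2^-1 ^+ p.+3], so by continuity it stays positive
   nearby. *)
have pos : 0 < 2 * 2^-1 + 2^-1 ^+ p.+3 - 2^-1 / (1 - 2^-1 : R).
  have -> : 2^-1 / (1 - 2^-1) = 1 :> R by field.
  by rewrite mulfV ?pnatr_eq0// addrAC subrr add0r exprn_gt0.
near=> lam; have l2 : 2^-1 < lam by near: lam; exact: nbhs_right_gt.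
have l1 : lam < 1 by near: lam; apply: nbhs_right_lt; lra.
have dp : 0 < 2 * lam + lam ^+ p.+3 - lam / (1 - lam).
  by near: lam; exact: cvgr_gt cont _ pos.
apply/andP; split.
  apply: (@le_trans _ _ (p%:R / p.+2%:R)%:E); first by rewrite lee_fin.
  by apply: hausdorff_dim_blocks => //; rewrite l2.
by apply: hausdorff_dim_Atilde_le1; rewrite l1 andbT; apply: lt_trans l2; lra.
Unshelve. all: by end_near. Qed.

Lemma hausdorff_dim_cvg : hausdorff_dim (Atilde lam) @[lam --> (2^-1 : R)^'+] --> 1%:E.
Proof.
apply/fine_cvgP; split.
  apply: filterS (hausdorff_dim_near 1 ltr01) => lam /andP[h1 h2].
  by apply/fin_numP; split; apply/eqP => h; rewrite h in h1 h2.
apply/cvgrPdist_le => e e0.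
apply: filterS (hausdorff_dim_near e e0) => lam /andP[] /=.
case: (hausdorff_dim (Atilde lam)) => //= r; rewrite !lee_fin => h1 h2.
by rewrite ler_norml; apply/andP; split; lra.
Qed.

End dimension_bounds.

(** * Local dimension *)

Section local_dimension.
Context {d : measure_display} {T : measurableType d} {R : realType}.
Variables (P : probability T R) (X : nat -> {RV P >-> bool}).
Hypothesis iidX : iid_fair_bits X.
Implicit Types (a : nat -> bool) (lam delta x r : R).

(** * Comparison of balls with cylinders *)

Definition cylinder a (n : nat) : set T :=
  [set w | forall i, (i < n)%N -> X i w = a i].

Lemma cylinderE a n : cylinder a n =
  \bigcap_(j in [set` [fset j in iota 0 n]%fset]) (X j @^-1` [set a j]).
Proof.
apply/seteqP; split => w /= H j.
  by rewrite /= !inE/= mem_iota add0n => jn; exact: H.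
by move=> jn; apply: H; rewrite /= !inE/= mem_iota add0n.
Qed.

Lemma measurable_cylinder a n : measurable (cylinder a n).
Proof.
rewrite cylinderE; apply: fin_bigcap_measurable => // j _.
by rewrite -[_ @^-1` _]setTI; exact: measurable_funPT.
Qed.

Lemma probability_cylinder a n : P (cylinder a n) = (2^-1 ^+ n)%:E.
Proof.
have [indep fair] := iidX.
rewrite cylinderE (indep _ (fun j => [set a j]))//.
have bitP j : P (X j @^-1` [set a j]) = (2^-1)%:E.
  have := congr1 (fun m => m [set a j]) (fair j); rewrite /distribution /= /pushforward => ->.
  rewrite bernoulli_probE; last by apply/andP; split; lra.
  rewrite !diracE /=; case: (a j).
    rewrite mem_set// memNset// mule1 mule0 adde0//.
  rewrite memNset// mem_set// mule1 mule0 add0e.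
  by congr (_%:E); rewrite /unstable.onem; lra.
under eq_bigr do rewrite bitP.
have pe : perm_eq [fset j in iota 0 n]%fset (iota 0 n).
  by apply: uniq_perm; [exact: fset_uniq|exact: iota_uniq|move=> j; rewrite !inE].
rewrite (perm_big _ pe) /= -[n in iota 0 n]subn0 -/(index_iota 0 n) {pe}.
elim: n => [|n IHn]; first by rewrite big_nil expr0.
by rewrite big_nat_recr//= IHn -EFinM exprSr.
Qed.

Lemma measurable_expansion lam : 0 < lam < 1 ->
  measurable_fun setT (fun w => expansion lam (fun n => X n w)).
Proof.
move=> /andP[l0 l1].
apply: (measurable_realfun.measurable_fun_cvg
  (h := fun n w => partial lam (fun n => X n w) n)).
  move=> n; apply: measurable_sum => i; apply: measurable_realfun.measurable_funM => //.
  move=> _ B mB; rewrite setTI.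
  rewrite -[_ @^-1` B]/(X i @^-1` [set b : bool | B b%:R]) -[_ @^-1` _]setTI.
  exact: measurable_funPT.
by move=> w _; exact: expansion_cvg.
Qed.

Lemma measurable_ball_event lam x r : 0 < lam < 1 ->
  measurable ((fun w => expansion lam (fun n => X n w)) @^-1` ball x r).
Proof.
move=> l01; rewrite -[_ @^-1` _]setTI; apply: measurable_expansion => //.
rewrite ball_itv; exact: measurable_itv.
Qed.

(** By [gap_dist], a digit sequence whose point falls in the ball shares its first [n] digits with
    [a]. *)
Lemma bernoulli_convolution_le lam delta a n r : 0 < lam < 1 -> 0 < delta ->
  gap lam delta a -> r <= lam ^+ n * delta ->
  (bernoulli_convolution X lam (ball (expansion lam a) r) <= (2^-1 ^+ n)%:E)%E.
Proof.
move=> l01 d0 ga rn; have /andP[l0 l1] := l01.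
rewrite -(probability_cylinder a n) /bernoulli_convolution /pushforward.
apply: le_measure.
- by rewrite inE; exact: measurable_ball_event.
- by rewrite inE; exact: measurable_cylinder.
move=> w; rewrite /= -ball_normE /= => wr; apply: contrapT.
move=> /existsNP[i /not_implyP[iN /eqP nE]].
have ex : exists i, a i != X i w by exists i; rewrite eq_sym.
case: (ex_minnP ex) => m mE mmin.
have below j : (j < m)%N -> a j = X j w.
  by move=> jm; apply/eqP/negPn/negP => /mmin; rewrite leqNgt jm.
have := gap_dist _ l0 l1 _ _ _ _ ga below mE.
have mn : (m <= n)%N by rewrite (leq_trans (mmin i _)) 1?eq_sym// ltnW.
have : lam ^+ n * delta <= lam ^+ m * delta.
  by rewrite ler_pM2r// ler_wiXn2l ?(ltW l0) ?(ltW l1).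
move=> h1 h2; have := lt_le_trans wr (le_trans rn (le_trans h1 h2)).
by rewrite ltxx.
Qed.

Lemma bernoulli_convolution_ge lam a n r : 0 < lam < 1 ->
  lam ^+ n * (lam / (1 - lam)) < r ->
  ((2^-1 ^+ n)%:E <= bernoulli_convolution X lam (ball (expansion lam a) r))%E.
Proof.
move=> l01 rn; have /andP[l0 l1] := l01.
rewrite -(probability_cylinder a n) /bernoulli_convolution /pushforward.
apply: le_measure.
- by rewrite inE; exact: measurable_cylinder.
- by rewrite inE; exact: measurable_ball_event.
move=> w /= Hw; rewrite -ball_normE /=; apply: le_lt_trans rn.
by apply: dist_expansion => // j jn; rewrite Hw.
Qed.

Lemma bernoulli_convolution_log lam delta a : 0 < lam < 1 -> 0 < delta ->
  gap lam delta a -> exists2 K, 0 < K & \forall r \near (0 : R)^'+,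
    exists2 m : R, bernoulli_convolution X lam (ball (expansion lam a) r) = m%:E &
      0 < m /\ `|ln m - sdim lam * ln r| <= K.
Proof.
move=> l01 d0 ga; have /andP[l0 l1] := l01.
have lnl : ln lam < 0 by exact: ln_lt0.
have ln2 : 0 < ln 2 :> R by rewrite ln_gt0// ltr1n.
pose s := sdim lam.
have sE : s * ln lam = - ln 2.
  by rewrite /s /sdim ltr0_norm//; field; rewrite lt_eqF.
pose c := lam / (1 - lam).
have c0 : 0 < c by rewrite divr_gt0// subr_gt0.
exists (`|s * ln delta| + `|s * ln c| + ln 2).
  by rewrite ltr_wpDl// addr_ge0.
near=> r; have r0 : 0 < r by near: r; exact: nbhs_right_gt.
have rd : r < delta by near: r; exact: nbhs_right_lt.
have rc : r < c by near: r; exact: nbhs_right_lt.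
(* [count z] is the real exponent at which a power of [lam] times [z] equals [r]. It is rounded down
   for the upper bound and up for the lower one, at a cost of at most [ln 2]. *)
pose count z := ln (r / z) / ln lam.
have countE z : 0 < z -> count z * ln 2 = s * ln z - s * ln r.
  move=> z0; rewrite -[ln 2]opprK -sE /count ln_div ?posrE//.
  by field; rewrite lt_eqF.
have count_ge0 z : 0 < z -> r < z -> 0 <= count z.
  move=> z0 rz; apply: mulr_le0; last by rewrite invr_le0 ltW.
  by apply: ln_le0; rewrite ler_pdivrMr// mul1r ltW.
have pow_ge z n : 0 < z -> n%:R <= count z -> r <= lam ^+ n * z.
  move=> z0; rewrite /count ler_ndivlMr// ln_div ?posrE// => h.
  rewrite -ler_ln ?posrE ?mulr_gt0 ?exprn_gt0//.
  by rewrite lnM ?posrE ?exprn_gt0// lnXn// -[ln lam *+ n]mulr_natl; lra.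
have pow_lt z n : 0 < z -> count z < n%:R -> lam ^+ n * z < r.
  move=> z0; rewrite /count ltr_ndivrMr// ln_div ?posrE// => h.
  rewrite -ltr_ln ?posrE ?mulr_gt0 ?exprn_gt0//.
  by rewrite lnM ?posrE ?exprn_gt0// lnXn// -[ln lam *+ n]mulr_natl; lra.
have /andP[n1 n2] := truncn_itv (count_ge0 _ d0 rd).
have /andP[k1 k2] := truncn_itv (count_ge0 _ c0 rc).
set n := Num.truncn (count delta) in n1 n2; set k := Num.truncn (count c) in k1 k2.
have up := bernoulli_convolution_le _ _ _ _ _ l01 d0 ga (pow_ge _ _ d0 n1).
have lo := bernoulli_convolution_ge _ a _ _ l01 (pow_lt _ _ c0 k2).
case: (bernoulli_convolution X lam _) up lo => [m| |] //.
rewrite !lee_fin => up lo; exists m => //.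
have half0 j : 0 < 2^-1 ^+ j :> R by rewrite exprn_gt0//; lra.
have m0 : 0 < m := lt_le_trans (half0 _) lo; split => //.
have lnhalf j : ln (2^-1 ^+ j : R) = - (j%:R * ln 2).
  by rewrite lnXn// lnV ?posrE// -[- ln 2 *+ j]mulr_natl mulrN.
have {}up : ln m <= - (n%:R * ln 2) by rewrite -lnhalf ler_ln ?posrE.
have {}lo : - (k.+1%:R * ln 2) <= ln m by rewrite -lnhalf ler_ln ?posrE.
have := countE _ d0; have := countE _ c0.
rewrite -/s ler_norml => ec ed.
have h1 : count delta * ln 2 <= (n%:R + 1) * ln 2.
  by rewrite ler_pM2r// natr1 ltW.
have h2 : (k.+1)%:R * ln 2 <= (count c + 1) * ln 2.
  by rewrite ler_pM2r// -natr1 lerD2r.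
have := ler_norm (s * ln delta); have := ler_norm (- (s * ln delta)).
have := ler_norm (s * ln c); have := ler_norm (- (s * ln c)).
rewrite !normrN => a1 a2 a3 a4.
by rewrite !mulrDl !mul1r in h1 h2; apply/andP; split; lra.
Unshelve. all: by end_near. Qed.

Lemma local_dim_Atilde lam x : 2^-1 < lam -> lam < 1 -> Atilde lam x ->
  has_local_dim (bernoulli_convolution X lam) x (sdim lam)%:E.
Proof.
move=> l2 l1 Ax; have l0 : 0 < lam by lra.
have l01 : 0 < lam < 1 by rewrite l0.
have [a [delta [-> d0 ga]]] := Atilde_expansion _ _ l01 l2 Ax.
have [K K0 HK] := bernoulli_convolution_log _ _ _ l01 d0 ga.
rewrite /has_local_dim; set f := (X in X @ _ --> _).
have key e : 0 < e -> \forall r \near (0 : R)^'+,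
    exists2 v : R, f r = v%:E & `|sdim lam - v| <= e.
  move=> e0; near=> r.
  have [m fm [m0 mK]] : exists2 m : R,
      bernoulli_convolution X lam (ball (expansion lam a) r) = m%:E &
      0 < m /\ `|ln m - sdim lam * ln r| <= K by near: r.
  have r0 : 0 < r by near: r; exact: nbhs_right_gt.
  (* Dividing the bounded error [K] by the absolute value of [ln r] then leaves at most [e]. *)
  have re : r < expR (- (K / e)).
    by near: r; apply: nbhs_right_lt; exact: expR_gt0.
  have lnr : ln r < - (K / e) by rewrite -[X in _ < X]expRK ltr_ln ?posrE ?expR_gt0.
  have Ke : 0 < K / e by rewrite divr_gt0.
  have lnr0 : ln r < 0 by lra.
  exists (ln m * (ln r)^-1); first by rewrite /f fm lne_EFin.
  have -> : sdim lam - ln m * (ln r)^-1 = (ln m - sdim lam * ln r) / - ln r.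
    by field; rewrite lt_eqF.
  rewrite normrM normfV (gtr0_norm (_ : 0 < - ln r)); last by rewrite oppr_gt0.
  rewrite ler_pdivrMr; last by rewrite oppr_gt0.
  by apply: (le_trans mK); rewrite mulrC -ler_pdivrMr// lerNr ltW.
apply/fine_cvgP; split.
  by apply: filterS (key 1 ltr01) => r [v ->].
by apply/cvgrPdist_le => e /key; apply: filterS => r /= [v ->].
Unshelve. all: by end_near. Qed.
End local_dimension.

Theorem theorem1p5 (R : realType) :
  (forall lam : R, 2^-1 < lam < golden ->
     Atilde lam `<=` Iset lam /\
     1 < sdim lam /\
     (forall (d : measure_display) (T : measurableType d)
        (P : probability T R) (X : nat -> {RV P >-> bool}),
        iid_fair_bits X ->
        forall x : R, Atilde lam x ->
          has_local_dim (bernoulli_convolution X lam) x (sdim lam)%:E)) /\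
  (forall lam : R, (beta_c R)^-1 < lam < golden ->
     countable (Atilde lam) /\ infinite_set (Atilde lam)) /\
  (forall lam : R, 2^-1 < lam < (beta_c R)^-1 ->
     (0%:E < hausdorff_dim (Atilde lam))%E) /\
  (hausdorff_dim (Atilde lam) @[lam --> (2^-1 : R)^'+] --> 1%:E).
Proof.
split.
  move=> lam lamg; have /andP[l2 _] := lamg; have /andP[l0 l1] := golden_lt1 _ lamg.
  split; first by move=> x [delta _ [[]]].
  split; last by move=> d T P X iidX x; exact: local_dim_Atilde.
  have lnl : ln lam < 0 by rewrite ln_lt0// l0.
  rewrite /sdim ltr0_norm// ltr_pdivlMr ?oppr_gt0// mul1r -lnV ?posrE//.
  by rewrite ltr_ln ?posrE ?invr_gt0// invf_plt ?posrE.
split.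
  move=> lam /andP[lb lg]; have [/andP[b2 _] _] := @beta_cP R.
  have lamg : 2^-1 < lam < golden by rewrite (le_lt_trans b2 lb).
  have /andP[_ l1] := golden_lt1 _ lamg.
  by split; [apply: countable_Atilde; rewrite lb|exact: infinite_Atilde].
split; last exact: hausdorff_dim_cvg.
move=> lam /andP[l2 lb]; apply: hausdorff_dim_gt0.
by rewrite lb andbT; apply: lt_trans l2; rewrite invr_gt0.
Qed.
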